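(* Let $R$ be a prime ring, let $d$ be a derivation of $R$, and let $n\geq 1$ be a fixed integer. Suppose that $(d(xy))^n=(d(x))^n(d(y))^n$ for all $x,y\in R$. Then $d=0$ or $R$ is commutative.
   Context: Rings are associative (not assumed to have an identity element). A derivation of a ring $R$ is an additive map $d:R\to R$ with $d(xy)=d(x)y+xd(y)$ for all $x,y\in R$. *)

(* Defs.v *)
From HB Require Import structures.
From mathcomp Require Import all_boot all_order all_algebra.

Set Implicit Arguments.
Unset Strict Implicit.
Unset Printing Implicit Defensive.

Import GRing.Theory.

Local Open Scope ring_scope.

(* Every MathComp ring structure has a unit element, so associative rings that
   need not have one are introduced here on top of abelian groups. *)
HB.mixin Record Zmodule_isNuRing R of GRing.Zmodule R := {
  numul : R -> R -> R;
  numulA : associative numul;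
  numulDl : left_distributive numul +%R;
  numulDr : right_distributive numul +%R
}.

#[short(type="nuRingType")]
HB.structure Definition NuRing := { R of Zmodule_isNuRing R & GRing.Zmodule R }.

(* x ^ n = x * (x * ...), with n factors; without a unit only n > 0 is
   meaningful, and the value 0 at n = 0 is a placeholder. *)
Definition nuexp (R : nuRingType) (x : R) (n : nat) : R := iterop n numul x 0.

Declare Scope nuring_scope.
Delimit Scope nuring_scope with nu.
Notation "x * y" := (numul x y) : nuring_scope.
Notation "x ^+ n" := (nuexp x n) : nuring_scope.
Notation "x + y" := (GRing.add x%nu y%nu) : nuring_scope.

Local Open Scope nuring_scope.

(* a R b = {0} implies a = 0 or b = 0 (the zero ring is not excluded). *)
Definition prime_nuring (R : nuRingType) : Prop :=
  forall a b : R, (forall r : R, a * r * b = 0%R) -> a = 0%R \/ b = 0%R.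

Definition derivation (R : nuRingType) (d : R -> R) : Prop :=
  {morph d : x y / x + y} /\ (forall x y : R, d (x * y) = d x * y + x * d y).

(* Main.v *)
Require Import Defs.
From HB Require Import structures.
From Stdlib Require Ncring Ncring_tac.
From mathcomp Require Import all_boot all_order all_algebra.
From mathcomp Require Import boolp.

Set Implicit Arguments.
Unset Strict Implicit.
Unset Printing Implicit Defensive.

Import GRing.Theory.

Local Open Scope ring_scope.

(** The hypothesis says that [x |-> d x ^+ n] is multiplicative, and this forces
    [d = 0]. The work takes place in the right Martindale quotient ring [Q] of
    [R], which is an algebra over the field [F] of its elements that commute with
    [R], the extended centroid; [mquotient] collects the properties that matter.
    Call the ring cornered if [a R b] lies in a finite-dimensional [F]-subspace
    of [Q] for some nonzero [a] and [b] ([finite_corner]).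

    Suppose first that it is not cornered ([no_corner_der0]). Fix [a] and
    linearize [d (a * y) ^+ n = d a ^+ n * d y ^+ n] completely in [y]
    ([polarize]). Such an identity is linear in each entry, and in the absence of
    finite corners a map [x |-> \sum p * x * q] of finite rank is zero, with
    vanishing left coefficients if the right ones are independent
    ([ev_finite_rank], [ev_head_eq0]). If [d] is not of the form
    [x |-> b * x - x * b] with [b] in [Q], then [d x] even behaves as a variable
    independent of [x] ([outer_der_part], a case of Kharchenko's theorem).
    Amitsur's lemma ([amitsur]) provides entries in general position, for which
    the products of the entries in different orders do not interfere; so the
    coefficients of the last entry may be compared ([sym_coef_eq0]). This removes
    the factors of the symmetrized products one at a time, and nothing is left
    but [d a = 0] in the outer case and a contradiction for generic [a] in the
    inner case.

    Suppose now that the ring is cornered ([finite_corner_der0]). If [s * t = 0]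
    then [y = t * x * s] has square [0], so [d y ^+ (n + n) = d (y * y) ^+ n = 0],
    and a theorem of Levitzki turns this into [s * d t = 0] ([zero_product]).
    Consequently [d] kills the idempotents of [Q] that have left denominators, and
    [d = 0] as soon as one of them is neither [0] nor [1]
    ([nontrivial_idempotent]). Finite-dimensional corners do produce idempotents
    ([corner_idempotent]), so if [d] is nonzero then [R] is a domain of finite
    dimension over [F]. It contains a nonzero central element [z]
    ([finite_domain_der0]); if [d z] is nonzero, computing [d (z ^ 2) ^+ n] and
    [d (z ^ 3) ^+ n] in two ways gives [4 ^ n = 3 ^ n] in [F], and then
    [z ^ (4 ^ n - 3 ^ n)] is a constant of [d] ([domain_central]). A nonzero
    constant [c] in a domain gives [(c * d x) ^+ n = d (c * x) ^+ n = 0] and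
    [d x = 0]. *)

(** * Rings without unit *)

Section NonUnital.
Variable R : nuRingType.
Implicit Types x y a b : R.

Lemma nu0r x : (0 * x)%nu = 0.
Proof. by apply: (@addrI _ (0 * x)%nu); rewrite -numulDl !addr0. Qed.

Lemma nur0 x : (x * 0)%nu = 0.
Proof. by apply: (@addrI _ (x * 0)%nu); rewrite -numulDr !addr0. Qed.

Lemma nuNr x y : ((- x) * y)%nu = - (x * y)%nu.
Proof. by apply: (@addrI _ (x * y)%nu); rewrite -numulDl !subrr nu0r. Qed.

Lemma nurN x y : (x * (- y))%nu = - (x * y)%nu.
Proof. by apply: (@addrI _ (x * y)%nu); rewrite -numulDr !subrr nur0. Qed.

Lemma nuBl x y z : ((x - y) * z)%nu = (x * z)%nu - (y * z)%nu.
Proof. by rewrite numulDl nuNr. Qed.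

Lemma nuBr x y z : (z * (x - y))%nu = (z * x)%nu - (z * y)%nu.
Proof. by rewrite numulDr nurN. Qed.

(** For an additive [S], to contain a nonzero two-sided ideal of the form [R a R];
    stated by means of products so as to apply to any predicate. *)
Definition large (S : R -> Prop) :=
  exists2 a, a <> 0 & forall r s, S (r * a * s)%nu.

Lemma large_imp (S T : R -> Prop) : (forall x, S x -> T x) -> large S -> large T.
Proof. by move=> ST [a a0 Sa]; exists a => // r s; apply: ST. Qed.

End NonUnital.

(** * Nonzero ideals of a prime ring *)

Section Prime.
Variable R : nuRingType.
Hypothesis primeR : prime_nuring R.
Implicit Types (x y a b r s t : R) (S T : R -> Prop).

Lemma prime_sep a b : a <> 0 -> b <> 0 -> exists r, (a * r * b)%nu <> 0.
Proof.
move=> a0 b0; apply: contrapT => H.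
by case: (@primeR a b) => // r; apply: contrapT => ?; apply: H; exists r.
Qed.

Lemma largeI S T : large S -> large T -> large (fun x => S x /\ T x).
Proof.
move=> [a a0 Sa] [b b0 Tb]; have [t c0] := prime_sep a0 b0.
exists (a * t * b)%nu => // r s; split.
  by have := Sa r (t * b * s)%nu; rewrite !numulA.
by have := Tb (r * a * t)%nu s; rewrite !numulA.
Qed.

Lemma large_annr x : large (fun u => (x * u)%nu = 0) -> x = 0.
Proof.
move=> [a a0 xa]; have [r|//|//] := @primeR x a.
apply: contrapT => n0; have [s] := prime_sep n0 a0; apply.
by have := xa r (s * a)%nu; rewrite !numulA.
Qed.

End Prime.

(** * The right Martindale quotient ring *)

Section Quotient.
Variable R : nuRingType.
Implicit Types (x y a b r s t : R).

(** A right-linear map to [R] from a right ideal that contains a nonzero ideal, as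
    a graph. The domain is maximal by [gr_max], so that elements of the quotient
    ring, which are germs of such maps, are equal exactly when the graphs are. *)
Record mquot := Mquot {
  gr : R -> R -> Prop;
  gr_sub : forall x y x' y', gr x y -> gr x' y' -> gr (x - x') (y - y');
  gr_mulr : forall x y r, gr x y -> gr (x * r)%nu (y * r)%nu;
  gr_fun : forall y, gr 0 y -> y = 0;
  gr_dom : large (fun x => exists y, gr x y);
  gr_max : forall x y, large (fun u => gr (x * u)%nu (y * u)%nu) -> gr x y }.

Definition pregraph (G : R -> R -> Prop) :=
  [/\ forall x y x' y', G x y -> G x' y' -> G (x - x') (y - y'),
      forall x y r, G x y -> G (x * r)%nu (y * r)%nu,
      forall y, G 0 y -> y = 0 &
      large (fun x => exists y, G x y)].

Lemma mquot_ext (p q : mquot) : gr p = gr q -> p = q.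
Proof.
case: p q => [G a b c d e] [H a' b' c' d' e'] /= GH; subst H.
by rewrite (Prop_irrelevance a a') (Prop_irrelevance b b')
  (Prop_irrelevance c c') (Prop_irrelevance d d') (Prop_irrelevance e e').
Qed.

Hypothesis primeR : prime_nuring R.
Hypothesis nzR : exists a : R, a <> 0.

Lemma largeT (S : R -> Prop) : (forall x, S x) -> large S.
Proof. by case: nzR => a a0 SA; exists a. Qed.

Definition mclosure (G : R -> R -> Prop) x y :=
  large (fun u => G (x * u)%nu (y * u)%nu).

Section Closure.
Variables (G : R -> R -> Prop) (pG : pregraph G).

Lemma mclosure_sub x y x' y' :
  mclosure G x y -> mclosure G x' y' -> mclosure G (x - x') (y - y').
Proof.
case: pG => Gs _ _ _ h h'; apply: large_imp (largeI primeR h h') => u [/= ? ?].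
by rewrite !nuBl; apply: Gs.
Qed.

Lemma mclosure_mulr x y r : mclosure G x y -> mclosure G (x * r)%nu (y * r)%nu.
Proof.
move=> [a a0 H]; exists a => // r' s.
by have := H (r * r')%nu s; rewrite !numulA.
Qed.

Lemma mclosure_fun y : mclosure G 0 y -> y = 0.
Proof.
case: pG => _ _ Gf _ H; apply: (large_annr primeR).
by apply: large_imp H => u /=; rewrite nu0r => /Gf.
Qed.

Lemma sub_mclosure x y : G x y -> mclosure G x y.
Proof. by case: pG => _ Gm _ _ Gxy; apply: largeT => u; apply: Gm. Qed.

Lemma mclosure_dom : large (fun x => exists y, mclosure G x y).
Proof.
by case: pG => _ _ _; apply: large_imp => x [y /sub_mclosure ?]; exists y.
Qed.

Lemma mclosure_max x y :
  large (fun u => mclosure G (x * u)%nu (y * u)%nu) -> mclosure G x y.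
Proof.
case: (pG) => Gs Gm Gf [b b0 domb] /(fun H => largeI primeR H _).
move=> /(_ (fun u => exists w, G (x * u)%nu w)) H.
have {}H : large (fun u => exists w, G (x * u)%nu w) -> mclosure G x y.
  move=> /H; apply: large_imp => u [/= Gc [w Gw]].
  suff -> : (y * u)%nu = w by [].
  apply/eqP; rewrite -subr_eq0; apply/eqP.
  apply: mclosure_fun; rewrite -(subrr (x * u)%nu).
  by apply: mclosure_sub => //; apply: sub_mclosure.
apply: H; exists b => // r s.
by have := domb (x * r)%nu s; rewrite !numulA.
Qed.

Definition mk_mquot : mquot :=
  @Mquot (mclosure G) mclosure_sub mclosure_mulr mclosure_fun mclosure_dom
    mclosure_max.

Lemma gr_mk x y : G x y -> gr mk_mquot x y.
Proof. exact: sub_mclosure. Qed.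

End Closure.

Implicit Types p q : mquot.

Lemma gr_funct p x y y' : gr p x y -> gr p x y' -> y = y'.
Proof.
move=> h h'; apply/eqP; rewrite -subr_eq0; apply/eqP; apply: (@gr_fun p).
by rewrite -(subrr x); apply: gr_sub.
Qed.

Lemma mquot_eq p q : large (fun x => exists2 y, gr p x y & gr q x y) -> p = q.
Proof.
suff H p' q' x y : large (fun x => exists2 y, gr p' x y & gr q' x y) ->
    gr p' x y -> gr q' x y.
  move=> h; apply: mquot_ext; apply/funext => x; apply/funext => y.
  rewrite propeqE; split; apply: H => //.
  by apply: large_imp h => z [w ? ?]; exists w.
move=> [a a0 h] px; apply: gr_max; exists a => // r s.
have [w] := h (x * r)%nu s; have := gr_mulr (r * a * s)%nu px.
by rewrite !numulA => /gr_funct pf /pf ->.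
Qed.

Lemma large_pre p (S : R -> Prop) :
  large S -> large (fun x => exists2 y, gr p x y & S y).
Proof.
move=> [a a0 Sa]; case: (gr_dom p) => b b0 pb.
have [t c0] := prime_sep primeR b0 a0; exists (b * t * a)%nu => // r s.
have [y /(gr_mulr (a * s)%nu)] := pb r t; rewrite !numulA => h.
by exists (y * a * s)%nu.
Qed.

Lemma large_dom p : large (fun x => exists y, gr p x y).
Proof. exact: gr_dom. Qed.

Definition addG p q x z := exists y1 y2, [/\ gr p x y1, gr q x y2 & z = y1 + y2].
Definition oppG p x z := gr p x (- z).
Definition mulG p q x z := exists2 y, gr q x y & gr p y z.
Definition lmulG a x z := z = (a * x)%nu.
Definition idG x z := z = x :> R.
Definition zeroG (x z : R) := z = 0.

Lemma addG_pre p q : pregraph (addG p q).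
Proof.
split.
- move=> x z x' z' [y1 [y2 [h1 h2 ->]]] [w1 [w2 [k1 k2 ->]]].
  exists (y1 - w1), (y2 - w2); split; [exact: gr_sub|exact: gr_sub|].
  by rewrite opprD addrACA.
- move=> x z r [y1 [y2 [h1 h2 ->]]]; exists (y1 * r)%nu, (y2 * r)%nu.
  by split; rewrite ?numulDl //; apply: gr_mulr.
- by move=> z [y1 [y2 [/gr_fun-> /gr_fun-> ->]]]; rewrite addr0.
- apply: large_imp (largeI primeR (large_dom p) (large_dom q)).
  by move=> x [[y1 ?] [y2 ?]]; exists (y1 + y2), y1, y2.
Qed.

Lemma oppG_pre p : pregraph (oppG p).
Proof.
split; rewrite /oppG.
- by move=> x z x' z' h h'; rewrite opprD; apply: gr_sub.
- by move=> x z r h; rewrite -nuNr; apply: gr_mulr.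
- by move=> z /gr_fun /eqP; rewrite oppr_eq0 => /eqP.
- by apply: large_imp (large_dom p) => x [y py]; exists (- y); rewrite opprK.
Qed.

Lemma mulG_pre p q : pregraph (mulG p q).
Proof.
split.
- by move=> x z x' z' [y ? ?] [y' ? ?]; exists (y - y'); apply: gr_sub.
- by move=> x z r [y ? ?]; exists (y * r)%nu; apply: gr_mulr.
- by move=> z [y /gr_fun-> /gr_fun].
- apply: large_imp (large_pre q (large_dom p)) => x [y qy [z pz]].
  by exists z, y.
Qed.

Lemma lmulG_pre a : pregraph (lmulG a).
Proof.
split; rewrite /lmulG.
- by move=> x z x' z' -> ->; rewrite nuBr.
- by move=> x z r ->; rewrite numulA.
- by move=> z ->; rewrite nur0.
- by apply: largeT => x; exists (a * x)%nu.
Qed.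

Lemma idG_pre : pregraph idG.
Proof.
split; rewrite /idG //; last by apply: largeT => x; exists x.
- by move=> x z x' z' -> ->.
- by move=> x z r ->.
Qed.

Lemma zeroG_pre : pregraph zeroG.
Proof.
split; rewrite /zeroG.
- by move=> x z x' z' -> ->; rewrite subrr.
- by move=> x z r ->; rewrite nu0r.
- by [].
- by apply: largeT => x; exists 0.
Qed.

Definition madd p q := mk_mquot (addG_pre p q).
Definition mopp p := mk_mquot (oppG_pre p).
Definition mmul p q := mk_mquot (mulG_pre p q).
Definition mlmul a := mk_mquot (lmulG_pre a).
Definition mone := mk_mquot idG_pre.
Definition mzero := mk_mquot zeroG_pre.

Lemma gr_add p q x y z : gr p x y -> gr q x z -> gr (madd p q) x (y + z).
Proof. by move=> ? ?; apply: gr_mk; exists y, z. Qed.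
Lemma gr_opp p x y : gr p x y -> gr (mopp p) x (- y).
Proof. by move=> ?; apply: gr_mk; rewrite /oppG opprK. Qed.
Lemma gr_mul p q x y z : gr q x y -> gr p y z -> gr (mmul p q) x z.
Proof. by move=> ? ?; apply: gr_mk; exists y. Qed.
Lemma gr_lmul a x : gr (mlmul a) x (a * x)%nu.
Proof. exact: gr_mk. Qed.
Lemma gr_one x : gr mone x x.
Proof. exact: gr_mk. Qed.
Lemma gr_zero x : gr mzero x 0.
Proof. exact: gr_mk. Qed.

Let largeI2 S T := @largeI R primeR S T.

Lemma maddA : associative madd.
Proof.
move=> p q r; apply: mquot_eq.
apply: large_imp (largeI2 (large_dom p) (largeI2 (large_dom q) (large_dom r))).
move=> x [[y py] [[z qz] [w rw]]].
by exists (y + (z + w)); last rewrite addrA; do 2 ?apply: gr_add.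
Qed.

Lemma maddC : commutative madd.
Proof.
move=> p q; apply: mquot_eq.
apply: large_imp (largeI2 (large_dom p) (large_dom q)) => x [[y py] [z qz]].
by exists (y + z); last rewrite addrC; apply: gr_add.
Qed.

Lemma madd0 : left_id mzero madd.
Proof.
move=> p; apply: mquot_eq; apply: large_imp (large_dom p) => x [y py].
by exists y => //; rewrite -[y]add0r; apply: gr_add => //; apply: gr_zero.
Qed.

Lemma maddN : left_inverse mzero mopp madd.
Proof.
move=> p; apply: mquot_eq; apply: large_imp (large_dom p) => x [y py].
exists 0; last exact: gr_zero.
by rewrite -(addNr y); apply: gr_add => //; apply: gr_opp.
Qed.

Lemma mmulA : associative mmul.
Proof.
move=> p q r; apply: mquot_eq.
apply: large_imp (large_pre r (large_pre q (large_dom p))).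
move=> x [y ry [z qz [w pw]]]; exists w.
  by apply: gr_mul pw; apply: gr_mul qz.
by apply: gr_mul ry _; apply: gr_mul pw.
Qed.

Lemma mmul1 : left_id mone mmul.
Proof.
move=> p; apply: mquot_eq; apply: large_imp (large_dom p) => x [y py].
by exists y => //; apply: gr_mul py _; apply: gr_one.
Qed.

Lemma mmulr1 : right_id mone mmul.
Proof.
move=> p; apply: mquot_eq; apply: large_imp (large_dom p) => x [y py].
by exists y => //; apply: gr_mul py; apply: gr_one.
Qed.

Lemma mmulDl : left_distributive mmul madd.
Proof.
move=> p q r; apply: mquot_eq.
apply: large_imp (large_pre r (largeI2 (large_dom p) (large_dom q))).
move=> x [y ry [[z pz] [w qw]]]; exists (z + w).
  by apply: gr_mul ry _; apply: gr_add.
by apply: gr_add; apply: gr_mul; eassumption.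
Qed.

Lemma mmulDr : right_distributive mmul madd.
Proof.
move=> p q r; apply: mquot_eq.
apply: large_imp (largeI2 (large_pre q (large_dom p)) (large_pre r (large_dom p))).
move=> x [[y qy [z pz]] [y' ry [z' pz']]]; exists (z + z').
  apply: gr_mul (gr_add qy ry) _.
  by have := gr_sub pz (gr_sub (gr_sub pz' pz') pz'); rewrite !subrr !sub0r !opprK.
by apply: gr_add; apply: gr_mul; eassumption.
Qed.

Lemma mone_neq0 : mone <> mzero.
Proof.
move=> e; case: nzR => a; apply.
by apply: (@gr_funct mone a) (gr_one a) _; rewrite e; apply: gr_zero.
Qed.

End Quotient.

(** The ring structure depends on the primeness of [R] and on [R] being nonzero, so
    the carrier carries both proofs as parameters. *)
Definition quot (R : nuRingType) (primeR : prime_nuring R)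
  (nzR : exists a : R, a <> 0) : Type := mquot R.

Section QuotRing.
Variables (R : nuRingType) (primeR : prime_nuring R).
Variable nzR : exists a : R, a <> 0.
Local Notation Q := (quot primeR nzR).

HB.instance Definition _ := gen_eqMixin Q.
HB.instance Definition _ := gen_choiceMixin Q.
HB.instance Definition _ := @GRing.isZmodule.Build Q _ _ _
  (maddA primeR nzR) (maddC primeR nzR) (madd0 primeR nzR) (maddN primeR nzR).

Fact quot_oner_neq0 : (mone primeR nzR : Q) != 0.
Proof. by apply/eqP; apply: mone_neq0. Qed.

HB.instance Definition _ := @GRing.Zmodule_isNzRing.Build Q _ _
  (mmulA primeR nzR) (mmul1 primeR nzR) (mmulr1 primeR nzR)
  (mmulDl primeR nzR) (mmulDr primeR nzR) quot_oner_neq0.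

Definition qi (a : R) : Q := mlmul primeR nzR a.

Lemma qiD a b : qi (a + b) = qi a + qi b.
Proof.
apply: mquot_eq => //; apply: largeT => // x; exists ((a + b) * x)%nu.
  exact: gr_lmul.
by rewrite numulDl; apply: gr_add; apply: gr_lmul.
Qed.

Lemma qiM a b : qi (a * b)%nu = qi a * qi b.
Proof.
apply: mquot_eq => //; apply: largeT => // x; exists (a * b * x)%nu.
  exact: gr_lmul.
by rewrite -numulA; apply: gr_mul; apply: gr_lmul.
Qed.

Lemma qi_inj a : qi a = 0 -> a = 0.
Proof.
move=> a0; apply: (large_annr primeR); apply: largeT => // x.
apply: (@gr_funct _ (qi a) x); first exact: gr_lmul.
by rewrite a0; apply: gr_zero.
Qed.

Lemma gr_qi (q : Q) u v : gr q u v -> q * qi u = qi v.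
Proof.
move=> quv; apply: mquot_eq => //; apply: largeT => // x.
exists (v * x)%nu; last exact: gr_lmul.
by apply: gr_mul (gr_lmul _ _ _ _) _; apply: gr_mulr.
Qed.

Lemma q_dom (q : Q) : large (fun u => exists v, q * qi u = qi v).
Proof. by apply: large_imp (gr_dom q) => u [v /gr_qi ?]; exists v. Qed.

Lemma q_faith (q : Q) : large (fun u => q * qi u = 0) -> q = 0.
Proof.
move=> H; apply: mquot_eq => //.
apply: large_imp (largeI primeR H (gr_dom q)) => u [h [v quv]].
exists v => //; have := gr_qi quv; rewrite h => /esym/qi_inj ->.
exact: gr_zero.
Qed.

Lemma q_lift (G : R -> R -> Prop) : pregraph G ->
  exists q : Q, forall x y, G x y -> q * qi x = qi y.
Proof.
move=> pG; exists (mk_mquot primeR nzR pG) => x y Gxy.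
by apply: gr_qi; apply: gr_mk.
Qed.

Definition central : {pred Q} := fun q => `[< forall r, q * qi r = qi r * q >].

Lemma central_comm (q p : Q) : q \in central -> q * p = p * q.
Proof.
move=> /asboolP qc; apply/eqP; rewrite -subr_eq0; apply/eqP; apply: q_faith.
apply: large_imp (q_dom p) => u [v puv].
by rewrite mulrBl -!mulrA qc puv qc [p * _]mulrA puv subrr.
Qed.

Fact central_subring : subring_closed central.
Proof.
split=> [|p q /asboolP cp /asboolP cq|p q /asboolP cp /asboolP cq].
- by apply/asboolP => r; rewrite mul1r mulr1.
- by apply/asboolP => r; rewrite mulrBl mulrBr cp cq.
- by apply/asboolP => r; rewrite -mulrA cq !mulrA cp.
Qed.

HB.instance Definition _ := GRing.isSubringClosed.Build Q central central_subring.

Record cen := Cen { cen_val :> Q; cen_valP : cen_val \in central }.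
HB.instance Definition _ := [isSub for cen_val].
HB.instance Definition _ := [Choice of cen by <:].
HB.instance Definition _ := [SubChoice_isSubNzRing of cen by <:].

Fact cen_mulC : commutative (@GRing.mul cen).
Proof. by move=> x y; apply: val_inj; apply: central_comm; apply: valP. Qed.
HB.instance Definition _ := GRing.PzRing_hasCommutativeMul.Build cen cen_mulC.

(** A nonzero [k] in the centroid is injective on [R] by primeness, and the inverse
    of its graph is the graph of an element of the quotient ring. *)
Fact cen_inv_ex (k : cen) : k != 0 -> exists h : cen, h * k = 1.
Proof.
move=> k0; have kc : forall r, val k * qi r = qi r * val k.
  exact/asboolP/(valP k).
have [u0 [v0 nv0 kuv]] : exists u0, exists2 v0, v0 <> 0 & val k * qi u0 = qi v0.
  apply: contrapT => H; case/negP: k0; apply/eqP/val_inj; apply: q_faith.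
  apply: large_imp (q_dom (val k)) => u [v kuv]; rewrite kuv.
  have [->|nv] := pselect (v = 0).
    by have := qiD 0 0; rewrite addr0 => /eqP; rewrite -subr_eq subrr eq_sym => /eqP.
  by case: H; exists u, v.
have kinj y : val k * qi y = 0 -> y = 0.
  move=> ky; have [r|//|//] := primeR (a := v0) (b := y).
  apply: qi_inj; rewrite !qiM -kuv kc -!mulrA [val k * (_ * _)]mulrA kc.
  by rewrite -mulrA ky !mulr0.
have qiB a b : qi (a - b) = qi a - qi b.
  by apply: (addIr (qi b)); rewrite -qiD !subrK.
pose G x y := val k * qi y = qi x.
have [|q Gq] := @q_lift G.
  split; rewrite /G.
  - by move=> x y x' y' h h'; rewrite !qiB mulrBr h h'.
  - by move=> x y r h; rewrite !qiM mulrA h.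
  - by move=> y h; apply: kinj; rewrite h -(subrr v0) qiB subrr.
  - exists v0 => // r s; exists (r * u0 * s)%nu.
    by rewrite !qiM !mulrA kc -[_ * _ * qi u0]mulrA kuv.
have qk : q * val k = 1.
  apply/eqP; rewrite -subr_eq0; apply/eqP; apply: q_faith.
  apply: large_imp (q_dom (val k)) => u [v kuv'].
  by rewrite mulrBl mul1r -mulrA kuv' (Gq _ _ kuv') subrr.
have kq : val k * q = 1 by rewrite central_comm ?qk //; apply: valP.
have qc : q \in central.
  apply/asboolP => r; rewrite -[LHS]mulr1 -kq mulrA -[_ * _ * val k]mulrA.
  by rewrite -kc mulrA qk mul1r.
by exists (Cen qc); apply: val_inj.
Qed.

Definition cen_inv (k : cen) : cen :=
  if pselect (k != 0) is left k0 then sval (cid (cen_inv_ex k0)) else 0.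

Fact cen_mulV (k : cen) : k != 0 -> cen_inv k * k = 1.
Proof. by rewrite /cen_inv; case: pselect => // k0 _; case: cid. Qed.

Fact cen_inv0 : cen_inv 0 = 0.
Proof. by rewrite /cen_inv; case: pselect => // k0; case/negP: (k0). Qed.

HB.instance Definition _ := GRing.ComNzRing_isField.Build cen cen_mulV cen_inv0.

Definition cen_scale (k : cen) (q : Q) : Q := val k * q.

Fact cen_scaleA a b v : cen_scale a (cen_scale b v) = cen_scale (a * b) v.
Proof. by rewrite /cen_scale mulrA. Qed.
Fact cen_scale1 : left_id 1 cen_scale.
Proof. by move=> v; apply: mul1r. Qed.
Fact cen_scaleDr : right_distributive cen_scale +%R.
Proof. by move=> a u v; apply: mulrDr. Qed.
Fact cen_scaleDl v : {morph cen_scale^~ v: a b / a + b}.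
Proof. by move=> a b; apply: mulrDl. Qed.

HB.instance Definition _ := @GRing.Zmodule_isLmodule.Build cen Q cen_scale
  cen_scaleA cen_scale1 cen_scaleDr cen_scaleDl.

Fact cen_scalerAl (a : cen) (u v : Q) : a *: (u * v) = (a *: u) * v.
Proof. exact: mulrA. Qed.
HB.instance Definition _ := GRing.Lmodule_isLalgebra.Build cen Q cen_scalerAl.
Fact cen_scalerAr (a : cen) (u v : Q) : a *: (u * v) = u * (a *: v).
Proof.
rewrite [LHS]mulrA [X in _ = u * X](erefl : _ = val a * v) mulrA.
by rewrite (central_comm u (valP a)).
Qed.
HB.instance Definition _ := GRing.Lalgebra_isAlgebra.Build cen Q cen_scalerAr.

Lemma q_cent (q : Q) : (forall r, q * qi r = qi r * q) ->
  exists k : cen, q = k%:A.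
Proof.
move=> /asboolP qc; exists (Cen qc).
exact/esym/(mulr1 (q : Q)).
Qed.

End QuotRing.

(** The properties of the quotient ring that characterize it up to isomorphism
    ([cli_inj], [cl_dom], [cl_faith], [cl_lift]), together with the identification
    of its scalars with the centralizer of [R]. *)
Record mquotient (R : nuRingType) := Mquotient {
  clF : fieldType;
  clQ : algType clF;
  cli : R -> clQ;
  cliD : forall x y, cli (x + y) = cli x + cli y;
  cliM : forall x y, cli (x * y)%nu = cli x * cli y;
  cli_inj : forall x, cli x = 0 -> x = 0;
  cl_dom : forall q, large (fun u => exists v, q * cli u = cli v);
  cl_faith : forall q, large (fun u => q * cli u = 0) -> q = 0;
  cl_lift : forall G, pregraph G ->
    exists q, forall x y, G x y -> q * cli x = cli y;
  cl_cent : forall q, (forall r, q * cli r = cli r * q) ->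
    exists k : clF, q = k%:A }.

Lemma mquotient_exists (R : nuRingType) :
  prime_nuring R -> (exists a : R, a <> 0) -> inhabited (mquotient R).
Proof.
move=> pR nz; constructor.
exact: (@Mquotient R (cen pR nz) (quot pR nz) (@qi R pR nz) (@qiD _ pR nz)
  (@qiM _ pR nz) (@qi_inj _ pR nz) (@q_dom _ pR nz) (@q_faith _ pR nz)
  (@q_lift _ pR nz) (@q_cent _ pR nz)).
Qed.

(** * Linear dependence modulo finitely many vectors *)

Section Span.
Variables (F : fieldType) (V : lmodType F).
Implicit Types (W vs : seq V) (u v w : V) (a b : nat -> F) (k : F).

Fixpoint spn W v : Prop :=
  if W is w :: W' then exists k, spn W' (v - k *: w) else v = 0.

Lemma spnZ W k v : spn W v -> spn W (k *: v).
Proof.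
elim: W v => [v ->|w W IH v [h Wv]] /=; first by rewrite scaler0.
by exists (k * h); rewrite -scalerA -scalerBr; apply: IH.
Qed.

Lemma spnD W u v : spn W u -> spn W v -> spn W (u + v).
Proof.
elim: W u v => [u v -> ->|w W IH u v [h Wu] [k Wv]] /=; first by rewrite addr0.
by exists (h + k); rewrite scalerDl opprD addrACA; apply: IH.
Qed.

Lemma spn0 W : spn W 0.
Proof. by elim: W => //= w W IH; exists 0; rewrite scale0r subr0. Qed.

Lemma spnN W v : spn W v -> spn W (- v).
Proof. by rewrite -scaleN1r; apply: spnZ. Qed.

Lemma spnB W u v : spn W u -> spn W v -> spn W (u - v).
Proof. by move=> Wu Wv; apply: spnD => //; apply: spnN. Qed.

Lemma spnBK W u v : spn W (u - v) -> spn W v -> spn W u.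
Proof. by move=> Wuv Wv; rewrite -[u](subrK v); apply: spnD. Qed.

Lemma spnDK W u v : spn W (u + v) -> spn W v -> spn W u.
Proof. by move=> Wuv Wv; rewrite -[u](addrK v); apply: spnB. Qed.

Lemma spnS w W v : spn W v -> spn (w :: W) v.
Proof. by move=> Wv; exists 0; rewrite scale0r subr0. Qed.

Lemma spn_mem W w : w \in W -> spn W w.
Proof.
elim: W => //= w' W IH; rewrite inE => /orP[/eqP <-|/IH/(spnS w')//].
by exists 1; rewrite scale1r subrr; apply: spn0.
Qed.

Lemma spn_trans W W' v : (forall w, w \in W -> spn W' w) -> spn W v -> spn W' v.
Proof.
elim: W v => [v _ ->|w W IH v WW' [k /IH Wv]]; first exact: spn0.
rewrite -[v](subrK (k *: w)); apply: spnD.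
  by apply: Wv => u uW; apply: WW'; rewrite inE uW orbT.
by apply/spnZ/WW'; rewrite inE eqxx.
Qed.

Lemma spn_subset W W' v : {subset W <= W'} -> spn W v -> spn W' v.
Proof. by move=> WW'; apply: spn_trans => w /WW'; apply: spn_mem. Qed.

Lemma spn_catr W W' v : spn W' v -> spn (W ++ W') v.
Proof. by apply: spn_subset => w; rewrite mem_cat orbC => ->. Qed.

Lemma spn_catl W W' v : spn W v -> spn (W ++ W') v.
Proof. by apply: spn_subset => w; rewrite mem_cat => ->. Qed.

Lemma spn_exchange w W v : spn (w :: W) v -> ~ spn W v -> spn (v :: W) w.
Proof.
move=> [k Wv] nv; have k0 : k != 0.
  by apply: contra_notN nv => /eqP k0; rewrite k0 scale0r subr0 in Wv.
exists k^-1; rewrite -[w](scalerK k0) -scalerBr -opprB.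
by apply/spnZ/spnN.
Qed.

Fixpoint lc a vs : V :=
  if vs is v :: vs' then a 0%N *: v + lc (fun i => a i.+1) vs' else 0.

Lemma lcB a b vs : lc a vs - lc b vs = lc (fun i => a i - b i) vs.
Proof.
elim: vs a b => [|v vs IH] a b /=; first by rewrite subr0.
by rewrite -IH scalerBl opprD addrACA.
Qed.

Lemma lc_spn a vs : spn vs (lc a vs).
Proof.
elim: vs a => //= v vs IH a; exists (a 0%N).
by rewrite addrAC subrr add0r.
Qed.

Lemma spn_lc W vs v : spn (vs ++ W) v -> exists a, spn W (v - lc a vs).
Proof.
elim: vs v => [v|w vs IH v [k /IH[a Wv]]] /=; first by exists (fun=> 0); rewrite subr0.
by exists (fun i => if i is j.+1 then a j else k); rewrite opprD addrA.
Qed.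

Arguments spn : simpl never.

Fixpoint free_mod W vs : Prop :=
  if vs is v :: vs' then ~ spn (vs' ++ W) v /\ free_mod W vs' else True.

Lemma free_lc W vs a : free_mod W vs -> spn W (lc a vs) ->
  forall i, (i < size vs)%N -> a i = 0.
Proof.
elim: vs a => //= v vs IH a [nv fvs] Wl.
have a0 : a 0%N = 0.
  apply: contra_notP nv => /eqP a0; rewrite -[v](scalerK a0); apply: spnZ.
  rewrite -[X in spn _ X](addrK (lc (fun i => a i.+1) vs)); apply: spnB.
    exact: spn_catr.
  by apply: spn_catl; apply: lc_spn.
rewrite a0 scale0r add0r in Wl.
by case=> // i /(IH _ fvs Wl).
Qed.

Lemma lc_eq a b vs : (forall i, (i < size vs)%N -> a i = b i) -> lc a vs = lc b vs.
Proof.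
elim: vs a b => //= v vs IH a b ab; rewrite ab //; congr (_ + _).
by apply: IH => i ?; apply: ab.
Qed.

Lemma free_lc_eq W vs a b : free_mod W vs -> spn W (lc a vs - lc b vs) ->
  forall i, (i < size vs)%N -> a i = b i.
Proof.
by move=> fvs; rewrite lcB => /(free_lc fvs) h i /h /eqP; rewrite subr_eq0 => /eqP.
Qed.

Lemma free_mod_sub W W' vs : (forall w, w \in W -> spn W' w) ->
  free_mod W' vs -> free_mod W vs.
Proof.
move=> WW'; elim: vs => //= v vs IH [nv /IH fvs]; split=> // h; apply: nv.
apply: spn_trans h => w; rewrite mem_cat => /orP[|/WW'].
  by move=> ?; apply/spn_catl/spn_mem.
exact: spn_catr.
Qed.

Lemma free_mod_cons v W vs : ~ spn (vs ++ W) v -> free_mod W vs ->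
  free_mod (v :: W) vs.
Proof.
elim: vs => //= w vs IH nv [nw fvs]; split; last first.
  by apply: IH => // h; apply/nv/spnS.
move=> h; apply: nv; apply: spn_exchange => //; apply: spn_subset h => u.
by rewrite !(mem_cat, inE) orbCA.
Qed.

Lemma free_mod_notin c W vs : free_mod (c :: W) vs -> ~ spn W c ->
  ~ spn (vs ++ W) c.
Proof.
move=> + nc; elim: vs => //= v vs IH [nv /IH h] /spn_exchange/(_ h) k; apply: nv.
by apply: spn_subset k => u; rewrite !(mem_cat, inE) orbCA.
Qed.

Lemma free_mod_size W vs U : free_mod U vs ->
  (forall v, v \in vs -> spn (W ++ U) v) -> (size vs <= size W)%N.
Proof.
elim: vs W U => //= v vs IH W U [nv fvs] vW.
have nUv : ~ spn U v by move=> /(@spn_catr vs).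
have vWU : spn (W ++ U) v by apply: vW; rewrite inE eqxx.
have [W1 [w [W2 [WE wv]]]] : exists W1 w W2,
    W = W1 ++ w :: W2 /\ spn (W1 ++ W2 ++ v :: U) w.
  elim: {vW} W vWU => //= w W IHW vWU.
  have [vW|nvW] := pselect (spn (W ++ U) v).
    have [W1 [w' [W2 [-> h]]]] := IHW vW; exists (w :: W1), w', W2.
    by split=> //; apply: spnS.
  exists [::], w, W; split=> //=; apply: spn_subset (spn_exchange vWU nvW) => u.
  by rewrite !(mem_cat, inE) orbCA.
rewrite WE size_cat /= addnS ltnS -size_cat; apply: (IH _ (v :: U)).
  exact: free_mod_cons.
move=> u uvs; have := vW u; rewrite inE uvs orbT => /(_ isT); apply: spn_trans.
rewrite -catA => x; rewrite WE !(mem_cat, inE) => xW.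
have [->//|xw] := eqVneq x w; apply: spn_mem; move: xW.
by rewrite !(mem_cat, inE) (negPf xw) /= => /orP[/orP[]|] ->; rewrite ?orbT.
Qed.

Lemma free_extract W (S : V -> Prop) : (forall v, S v -> spn W v) ->
  exists vs, [/\ free_mod [::] vs, forall v, v \in vs -> S v &
                 forall v, S v -> spn vs v].
Proof.
move=> SW; suff H n vs : (n + size vs = size W)%N -> free_mod [::] vs ->
    (forall v, v \in vs -> S v) -> exists vs, [/\ free_mod [::] vs,
    forall v, v \in vs -> S v & forall v, S v -> spn vs v].
  by apply: (H (size W) [::]); rewrite ?addn0.
elim: n vs => [|n IH] vs szvs fvs vsS.
all: have [[v [Sv nv]]|h] := pselect (exists v, S v /\ ~ spn vs v);
  last by exists vs; split=> // v Sv; apply: contrapT => nv; apply: h; exists v.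
all: have vvsS u : u \in v :: vs -> S u by rewrite inE => /orP[/eqP->|/vsS].
  have: (size (v :: vs) <= size W)%N; last by rewrite -szvs ltnn.
  apply: (@free_mod_size _ _ [::]); first by split=> //; rewrite cats0.
  by move=> u /vvsS /SW; rewrite cats0.
apply: (IH (v :: vs)) => //; first by rewrite addnS.
by split=> //; rewrite cats0.
Qed.

End Span.

Arguments spn : simpl never.

(** * Values of additive maps in general position *)

Section Amitsur.
Variables (F : fieldType) (V : lmodType F) (G : zmodType).
Implicit Types (U : seq (G -> V)) (W : seq V) (a : nat -> F).

Fixpoint alls (P : (G -> V) -> Prop) U : Prop :=
  if U is f :: U' then P f /\ alls P U' else True.

Definition evl U z : seq V := [seq f z | f <- U].

Definition add_map (f : G -> V) := {morph f : x y / x + y}.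

Definition no_finite_rank U := forall a, (exists2 i, (i < size U)%N & a i != 0) ->
  forall W, exists z, ~ spn W (lc a (evl U z)).

Lemma add_lc U a : alls add_map U -> add_map (fun z => lc a (evl U z)).
Proof.
move=> + x y; elim: U a => /= [a _|f U IH a [fD /IH UD]]; first by rewrite addr0.
by rewrite fD scalerDr UD addrACA.
Qed.

Lemma free_shift U W x z : alls add_map U ->
  free_mod (evl U x ++ W) (evl U z) -> free_mod W (evl U (z + x)).
Proof.
elim: U W => //= f U IH W [fD UD] [nf fU]; split; last first.
  apply: IH => //; apply: free_mod_sub fU => w; rewrite !mem_cat => wUW.
  by apply: spn_mem; rewrite inE mem_cat wUW orbT.
have {nf fU} nf : ~ spn (evl U z ++ f x :: evl U x ++ W) (f z) by [].
move=> /spn_lc[a Wa]; apply: nf.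
rewrite fD (add_lc a UD) in Wa.
rewrite -[f z](addrK (f x)); apply: spnB; last first.
  by apply: spn_mem; rewrite mem_cat inE eqxx orbT.
apply: spnBK (spn_catr _ (spnS _ (spn_catr _ Wa))) _; apply: spnD.
  exact/spn_catl/lc_spn.
exact/spn_catr/spnS/spn_catl/lc_spn.
Qed.

(** Amitsur's lemma. If it fails on adding [T] to [U], then [T z] is a combination
    of the values [U z] modulo [W] whenever these are independent modulo [W]. For
    any [z1], [z] and a point [z2] generic with respect to them, the coefficients
    at [z2], [z2 + z1] and [z2 + z] are the same, and by subtraction they serve at
    [z1] and at [z]. So one combination of [T :: U] has all its values in the span
    of [W]. *)
Lemma amitsur U : alls add_map U -> no_finite_rank U ->
  forall W, exists z, free_mod W (evl U z).
Proof.
elim: U => [_ _ W|T U IH [TD UD] nfr W]; first by exists 0.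
have {}IH : forall W, exists z, free_mod W (evl U z).
  apply: IH => // a [i iU ai0] W'.
  have [|z nz] := nfr (fun j => if j is i.+1 then a i else 0) _ W'.
    by exists i.+1.
  by exists z => h; apply: nz; rewrite /= scale0r add0r.
apply: contrapT => H.
have dep z : free_mod W (evl U z) -> exists a, spn W (T z - lc a (evl U z)).
  move=> fz; apply: spn_lc; apply: contrapT => nz; apply: H.
  by exists z.
have [z1 fz1] := IH W; have [a Wa] := dep _ fz1.
have [] := nfr (fun j => if j is i.+1 then - a i else 1) _ W.
  by exists 0%N => //; apply: oner_neq0.
move=> z; apply.
have -> : lc (fun j => if j is i.+1 then - a i else 1) (evl (T :: U) z) =
    T z - lc a (evl U z).
  rewrite /= scale1r; congr (_ + _); rewrite -[RHS]add0r.
  have -> : 0 = lc (fun=> 0) (evl U z).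
    by elim: (U) => //= f U' IHU; rewrite scale0r add0r -IHU.
  by rewrite lcB; apply: lc_eq => i _; rewrite sub0r.
have [z2 fz2] := IH (T z :: evl U z ++ evl U z1 ++ W).
have fz2W (X : seq V) : {subset X <= T z :: evl U z ++ evl U z1 ++ W} ->
    free_mod X (evl U z2).
  by move=> XS; apply: free_mod_sub fz2 => w /XS; apply: spn_mem.
have fz2' : free_mod W (evl U z2).
  by apply: fz2W => w; rewrite !(mem_cat, inE) => ->; rewrite !orbT.
have fz21 : free_mod W (evl U (z2 + z1)).
  apply: free_shift => //; apply: fz2W => w.
  by rewrite !(mem_cat, inE) => /orP[] ->; rewrite !orbT.
have fz2z : free_mod W (evl U (z2 + z)).
  apply: free_shift => //; apply: fz2W => w.
  by rewrite !(mem_cat, inE) => /orP[] ->; rewrite !orbT.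
have [b Wb] := dep _ fz2'; have [c Wc] := dep _ fz21; have [e We] := dep _ fz2z.
have dropz2 (X : seq V) z' g : {subset W <= X} ->
    spn X (T z2 - lc g (evl U z2)) ->
    spn W (T (z2 + z') - lc g (evl U (z2 + z'))) ->
    spn X (T z' - lc g (evl U z')).
  move=> WX Xg /(spn_subset WX); rewrite TD (add_lc g UD) opprD addrACA addrC.
  by move=> /spnDK; apply.
have same (X : seq V) z' g : {subset W <= X} -> {subset evl U z' <= X} ->
    {subset X <= T z :: evl U z ++ evl U z1 ++ W} -> spn X (T z') ->
    spn W (T (z2 + z') - lc g (evl U (z2 + z'))) ->
    forall i, (i < size (evl U z2))%N -> g i = b i.
  move=> WX UX XS XT /(spn_subset WX) Wg; apply: (free_lc_eq (fz2W _ XS)).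
  rewrite -(subrKA (T z2)) addrC; apply: spnD.
    exact: (spn_subset WX).
  rewrite -opprB; apply: spnN; apply: (@spnDK _ _ _ _ (T z' - lc g (evl U z'))).
    by move: Wg; rewrite TD (add_lc g UD) opprD addrACA.
  by apply: spnB => //; apply/(spn_subset UX)/lc_spn.
have sz x : size (evl U x) = size U by rewrite size_map.
have cb : forall i, (i < size U)%N -> c i = b i.
  move=> i; rewrite -(sz z2); apply: (same (evl U z1 ++ W) z1) Wc i.
  - by move=> w; rewrite mem_cat orbC => ->.
  - by move=> w; rewrite mem_cat => ->.
  - by move=> w; rewrite !(inE, mem_cat) => /orP[] ->; rewrite !orbT.
  - by apply: spnBK (spn_catr _ Wa) _; apply/spn_catl/lc_spn.
have eb : forall i, (i < size U)%N -> e i = b i.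
  move=> i; rewrite -(sz z2); apply: (same (T z :: evl U z ++ W) z) We i.
  - by move=> w; rewrite !(inE, mem_cat) => ->; rewrite !orbT.
  - by move=> w; rewrite !(inE, mem_cat) => ->; rewrite !orbT.
  - by move=> w; rewrite !(inE, mem_cat) => /or3P[] ->; rewrite ?orbT.
  - by apply: spn_mem; rewrite inE eqxx.
have Wbz2 g : (forall i, (i < size U)%N -> g i = b i) ->
    spn W (T z2 - lc g (evl U z2)).
  by move=> gb; rewrite (@lc_eq _ _ g b) // => i; rewrite sz; apply: gb.
have Wcz1 := dropz2 W z1 c (fun _ h => h) (Wbz2 c cb) Wc.
have Wez := dropz2 W z e (fun _ h => h) (Wbz2 e eb) We.
have ca : forall i, (i < size (evl U z1))%N -> c i = a i.
  apply: (free_lc_eq fz1); rewrite -(subrKA (T z1)) addrC; apply: spnD => //.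
  by rewrite -opprB; apply: spnN.
rewrite (@lc_eq _ _ a e) // => i; rewrite sz => iU.
by rewrite eb // -cb // ca // sz.
Qed.

(** Genericity can be combined with any non-vanishing condition on [z]: if [P]
    is additive and nonzero at [x0] then it is nonzero at one of [z], [z + x0],
    and both points are generic as soon as [z] is generic modulo the values at
    [x0]. *)
Lemma amitsur_nz U (P : G -> V) x0 W : alls add_map U -> no_finite_rank U ->
  add_map P -> P x0 <> 0 -> exists2 z, P z <> 0 & free_mod W (evl U z).
Proof.
move=> UD nfr PD P0; have [z fz] := amitsur UD nfr (evl U x0 ++ W).
have [Pz|Pz] := pselect (P z = 0); last first.
  exists z => //; apply: free_mod_sub fz => w wW.
  by apply: spn_mem; rewrite mem_cat wW orbT.
by exists (z + x0); [rewrite PD Pz add0r|apply: free_shift].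
Qed.

(** The maps of [U] that are combinations of the others can be dropped without
    changing the span of the values; the remaining ones have no combination of
    finite rank, and [c] stays outside the span of their values at a point that is
    generic modulo [c :: W]. *)
Lemma generic_avoid (E : (G -> V) -> Prop) :
  (forall f, E f -> add_map f) ->
  (forall U a, alls E U -> E (fun z => lc a (evl U z))) ->
  (forall f W, E f -> (forall z, spn W (f z)) -> forall z, f z = 0) ->
  forall U (P : G -> V) x0 W c, alls E U -> add_map P -> P x0 <> 0 ->
    ~ spn W c -> exists2 z, P z <> 0 & ~ spn (evl U z ++ W) c.
Proof.
move=> Eadd Elc Efr U P x0 W c EU PD P0 nc.
have [U0 [EU0 nfr UU0]] : exists U0, [/\ alls E U0, no_finite_rank U0 &
    forall z w, w \in evl U z -> spn (evl U0 z) w].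
  elim: U EU => [_|f U IH [Ef /IH[U0 [EU0 nfr UU0]]]].
    by exists [::]; split=> // a [].
  have [nfr'|] := pselect (no_finite_rank (f :: U0)).
    exists (f :: U0); split=> // z w /=; rewrite inE => /orP[/eqP->|/UU0/spnS//].
    by apply: spn_mem; rewrite inE eqxx.
  move=> /existsNP[a /not_implyP[[i iU ai0] /existsNP[W' /forallNP h]]].
  have {}h z : spn W' (lc a (evl (f :: U0) z)) by apply: contrapT.
  have {h} a0 := Efr _ _ (Elc (f :: U0) a (conj Ef EU0)) h.
  exists U0; split=> // z w /=; rewrite inE => /orP[/eqP->|/UU0//].
  have [a00|a00] := eqVneq (a 0%N) 0.
    have [|z' []] := nfr (fun i => a i.+1) _ [::].
      case: i iU ai0 => [_|i]; first by rewrite a00 eqxx.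
      by move=> iU ai0; exists i.
    by have := a0 z'; rewrite /= a00 scale0r add0r.
  rewrite -[f z](scalerK a00); apply: spnZ; have /eqP := a0 z.
  by rewrite /= addr_eq0 => /eqP ->; apply/spnN/lc_spn.
have UD : alls add_map U0 by elim: (U0) EU0 => //= f U' IH [/Eadd ? /IH].
have [z Pz fz] := amitsur_nz (c :: W) UD nfr PD P0; exists z => // h.
apply: (free_mod_notin fz nc); apply: spn_trans h => w.
rewrite mem_cat => /orP[/UU0|wW]; first exact: spn_catl.
by apply/spn_catr/spn_mem.
Qed.

End Amitsur.

(** * Generalized polynomials of degree one *)

Section NcRing.
Variable Q : nzRingType.

#[export] Instance nc_ops :
  @Ncring.Ring_ops Q 0 1 +%R *%R (fun x y => x - y) -%R eq := {}.

#[export] Instance nc_ring : Ncring.Ring (Ro := nc_ops).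
Proof.
split; try solve [exact: addrC | exact: mul1r | exact: mulr1 | exact: add0r
                | exact: subrr | by []].
- exact: RelationClasses.eq_equivalence.
- by move=> x y -> z t ->.
- by move=> x y -> z t ->.
- by move=> x y -> z t ->.
- by move=> x y ->.
- by move=> *; apply: addrA.
- by move=> *; apply: mulrA.
- by move=> *; apply: mulrDl.
- by move=> *; apply: mulrDr.
Qed.
End NcRing.

Ltac ncring := Ncring_tac.non_commutative_ring.

Section Tensor.
Variables (R : nuRingType) (primeR : prime_nuring R) (K : mquotient R).
Local Notation F := (clF K).
Local Notation Q := (clQ K).
Local Notation i := (@cli R K).
Implicit Types (x y z r s u v : R) (p q A B : Q) (W : seq Q).

Lemma i0 : i 0 = 0.
Proof. by apply: (addIr (i 0)); rewrite -cliD !add0r. Qed.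

Lemma iN x : i (- x) = - i x.
Proof. by apply: (addIr (i x)); rewrite -cliD !addNr i0. Qed.

Lemma iB x y : i (x - y) = i x - i y.
Proof. by rewrite cliD iN. Qed.

Lemma i_inj x y : i x = i y -> x = y.
Proof.
move=> e; apply/eqP; rewrite -subr_eq0; apply/eqP.
by apply: (@cli_inj _ K); rewrite iB e subrr.
Qed.

Lemma i_sum (I : Type) (l : seq I) (f : I -> R) :
  i (\sum_(j <- l) f j) = \sum_(j <- l) i (f j).
Proof. by elim/big_rec2: _ => [|j ? ? _ <-]; rewrite ?i0 ?cliD. Qed.

Lemma ncancel q : (forall u v, q * i u = i v -> v = 0) -> q = 0.
Proof.
move=> h; apply: cl_faith; apply: large_imp (cl_dom q) => u [v quv].
by rewrite quv (h _ _ quv) i0.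
Qed.

Lemma q_nz q : q <> 0 -> exists u v, v <> 0 /\ q * i u = i v.
Proof.
move=> q0; apply: contrapT => h; apply: q0; apply: ncancel => u v quv.
by apply: contrapT => v0; apply: h; exists u, v.
Qed.

Lemma prime_i x q : x <> 0 -> (forall r, i x * i r * q = 0) -> q = 0.
Proof.
move=> x0 h; apply: ncancel => u v quv.
have [r|//|//] := primeR (a := x) (b := v).
by apply: (@cli_inj _ K); rewrite !cliM -quv mulrA h mul0r.
Qed.

(** The multiplication operator given by an element of the tensor product of [R]
    with itself. *)
Definition mop (E : seq (R * R)) q : Q := \sum_(e <- E) i e.1 * q * i e.2.

Lemma mopB E p q : mop E (p - q) = mop E p - mop E q.
Proof. by rewrite -sumrB; apply: eq_bigr => e _; rewrite mulrBr mulrBl. Qed.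

Lemma mopZ E k q : mop E (k *: q) = k *: mop E q.
Proof.
by rewrite scaler_sumr; apply: eq_bigr => e _; rewrite -scalerAr -scalerAl.
Qed.

Lemma mop_cat E E' q : mop (E ++ E') q = mop E q + mop E' q.
Proof. exact: big_cat. Qed.

Lemma mop_opp E q : mop [seq (- e.1, e.2) | e <- E] q = - mop E q.
Proof.
by rewrite /mop big_map -sumrN; apply: eq_bigr => e _ /=; rewrite iN !mulNr.
Qed.

Lemma mop_mul E x u q :
  mop [seq ((x * e.1)%nu, (e.2 * u)%nu) | e <- E] q = i x * mop E q * i u.
Proof.
rewrite /mop big_map mulr_sumr mulr_suml; apply: eq_bigr => e _ /=.
by rewrite !cliM !mulrA.
Qed.

Lemma mop_mulr E u q : mop [seq (e.1, (e.2 * u)%nu) | e <- E] q = mop E q * i u.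
Proof.
rewrite /mop big_map mulr_suml; apply: eq_bigr => e _ /=.
by rewrite !cliM !mulrA.
Qed.

Lemma mop_mull E x q : mop [seq ((x * e.1)%nu, e.2) | e <- E] q = i x * mop E q.
Proof.
rewrite /mop big_map mulr_sumr; apply: eq_bigr => e _ /=.
by rewrite !cliM !mulrA.
Qed.

Lemma mop_spn E W q : (forall w, w \in W -> mop E w = 0) -> spn W q ->
  mop E q = 0.
Proof.
elim: W q => [q _ ->|w W IH q WE [k /IH h]].
  by rewrite -[0 in LHS](subrr 0) mopB subrr.
have /eqP := h (fun w' w'W => WE w' (@mem_behead _ (w :: W) _ w'W)).
by rewrite mopB mopZ (WE w) ?inE ?eqxx // scaler0 subr0 => /eqP.
Qed.

(** Density of the multiplication operators: the obstruction to separating [b]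
    from [b1 :: Bs] is a bimodule map on the values of [b1] under the operators
    killing [Bs]; such a map is multiplication by a scalar. *)
Lemma mop_separate Bs b : ~ spn Bs b ->
  exists2 E, mop E b <> 0 & forall b', b' \in Bs -> mop E b' = 0.
Proof.
elim: Bs b => [b b0|b1 Bs IH b nb].
  have [u [v [v0 buv]]] := q_nz b0; have [r vr] := prime_sep primeR v0 v0.
  exists [:: ((v * r)%nu, u)] => //; rewrite /mop big_seq1 /= -mulrA buv -cliM.
  by move/(@cli_inj _ K).
have [b1W|nb1] := pselect (spn Bs b1).
  have [|E Eb EBs] := IH b; first by move/(spnS b1).
  by exists E => // b'; rewrite inE => /orP[/eqP->|/EBs//]; apply: mop_spn b1W.
apply: contrapT => nE.
have {nE}Kill E : (forall b', b' \in Bs -> mop E b' = 0) -> mop E b1 = 0 ->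
    mop E b = 0.
  move=> EBs Eb1; apply: contrapT => Eb; apply: nE; exists E => // b'.
  by rewrite inE => /orP[/eqP->|/EBs].
pose G x y := exists E, [/\ forall b', b' \in Bs -> mop E b' = 0,
  i x = mop E b1 & i y = mop E b].
have [E1 E1b1 E1Bs] := IH _ nb1.
have Gdom : large (fun x => exists y, G x y).
  have [u [v [w [v0 uv uw]]]] : exists u v w,
      [/\ v <> 0, mop E1 b1 * i u = i v & mop E1 b * i u = i w].
    apply: contrapT => h; apply: E1b1; apply: cl_faith.
    apply: large_imp (largeI primeR (cl_dom (mop E1 b1)) (cl_dom (mop E1 b))).
    move=> u [[v uv] [w uw]]; rewrite uv; have [->|v0] := pselect (v = 0).
      exact: i0.
    by case: h; exists u, v, w.
  exists v => // r s; exists (r * w * s)%nu.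
  exists [seq ((r * e.1)%nu, (e.2 * (u * s))%nu) | e <- E1]; split.
  - by move=> b' /E1Bs h; rewrite mop_mul h mulr0 mul0r.
  - by rewrite mop_mul !cliM -uv !mulrA.
  - by rewrite mop_mul !cliM -uw !mulrA.
have [|lam lamG] := @cl_lift _ K G.
  split => // [x y x' y' [E [h1 h2 h3]] [E' [h1' h2' h3']]||].
  - exists (E ++ [seq (- e.1, e.2) | e <- E']); split.
    + by move=> b' bb; rewrite mop_cat mop_opp h1 // h1' // oppr0 addr0.
    + by rewrite mop_cat mop_opp iB h2 h2'.
    + by rewrite mop_cat mop_opp iB h3 h3'.
  - move=> x y r [E [h1 h2 h3]]; exists [seq (e.1, (e.2 * r)%nu) | e <- E].
    split; rewrite ?mop_mulr ?cliM ?h2 ?h3 // => b' bb.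
    by rewrite mop_mulr h1 // mul0r.
  - move=> y [E [h1 h2 h3]]; apply: (@cli_inj _ K); rewrite h3; apply: Kill => //.
    by rewrite -h2 i0.
have [k lamk] : exists k : F, lam = k%:A.
  apply: cl_cent => r; apply/eqP; rewrite -subr_eq0; apply/eqP; apply: cl_faith.
  apply: large_imp Gdom => x [y Gxy].
  rewrite mulrBl -!mulrA -cliM (lamG _ _ Gxy) -cliM (lamG _ (r * y)%nu) ?subrr //.
  case: Gxy => E [h1 h2 h3]; exists [seq ((r * e.1)%nu, e.2) | e <- E].
  split; rewrite ?mop_mull ?cliM ?h2 ?h3 // => b' bb.
  by rewrite mop_mull h1 // mulr0.
apply: nb; exists k; apply: contrapT => /IH[E Eb EBs]; apply: Eb.
rewrite mopB mopZ; apply: cl_faith.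
apply: large_imp (largeI primeR (cl_dom (mop E b1)) (cl_dom (mop E b))).
move=> u [[v uv] [w uw]]; rewrite mulrBl -scalerAl uv uw.
have := lamG v w; rewrite lamk -scalerAl mul1r => ->; first exact: subrr.
exists [seq (e.1, (e.2 * u)%nu) | e <- E]; split; rewrite ?mop_mulr // => b' bb.
by rewrite mop_mulr EBs // mul0r.
Qed.

(** The value at [q] of the generalized polynomial [\sum p * x * p'] in [x]. *)
Definition ev (L : seq (Q * Q)) q : Q := \sum_(e <- L) e.1 * q * e.2.

Lemma ev_cons e L q : ev (e :: L) q = e.1 * q * e.2 + ev L q.
Proof. exact: big_cons. Qed.

Lemma ev_cat L L' q : ev (L ++ L') q = ev L q + ev L' q.
Proof. exact: big_cat. Qed.

Lemma ev_mull L p q : p * ev L q = ev [seq (p * e.1, e.2) | e <- L] q.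
Proof. by rewrite /ev big_map mulr_sumr; apply: eq_bigr => e _; rewrite !mulrA. Qed.

Lemma ev_mulr L p q : ev L q * p = ev [seq (e.1, e.2 * p) | e <- L] q.
Proof. by rewrite /ev big_map mulr_suml; apply: eq_bigr => e _; rewrite !mulrA. Qed.

Lemma ev_arg L p q p' : ev L (p * q * p') = ev [seq (e.1 * p, p' * e.2) | e <- L] q.
Proof. by rewrite /ev big_map; apply: eq_bigr => e _; rewrite !mulrA. Qed.

Lemma evZ L k q : k *: ev L q = ev [seq (k *: e.1, e.2) | e <- L] q.
Proof.
by rewrite /ev big_map scaler_sumr; apply: eq_bigr => e _; rewrite -!scalerAl.
Qed.

Lemma evD L p q : ev L (p + q) = ev L p + ev L q.
Proof. by rewrite -big_split; apply: eq_bigr => e _; rewrite mulrDr mulrDl. Qed.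

Lemma ev0 L : ev L 0 = 0.
Proof. by apply: (addIr (ev L 0)); rewrite -evD !add0r. Qed.

Lemma spn_cong W p q : p = q -> spn W p -> spn W q.
Proof. by move=> ->. Qed.

Lemma spn_mul W p q (t : Q) : spn W t -> spn [seq p * w * q | w <- W] (p * t * q).
Proof.
elim: W t => [t ->|w W IH t [k /IH h]]; first by rewrite mulr0 mul0r.
exists k; suff -> : p * t * q - k *: (p * w * q) = p * (t - k *: w) * q by [].
by rewrite mulrBr mulrBl -scalerAr -scalerAl.
Qed.

Definition finite_corner := exists a b W,
  [/\ a <> 0, b <> 0 & forall x, spn W (i a * i x * i b)].

(** A coefficient that is linearly dependent on others can be absorbed by them.
    The statement quantifies over all linear [T] applied to the left factors, as
    the same rewriting is needed simultaneously for a family of such [T]. *)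
Lemma tensor_absorb (L : seq (Q * Q)) A B : spn [seq e.2 | e <- L] B ->
  exists2 L', [seq e.2 | e <- L'] = [seq e.2 | e <- L] &
    forall T : Q -> Q, (forall p q, T (p + q) = T p + T q) ->
      (forall (k : F) p, T (k *: p) = k *: T p) ->
    forall q, T A * q * B + \sum_(e <- L) T e.1 * q * e.2 =
              \sum_(e <- L') T e.1 * q * e.2.
Proof.
elim: L B => [B ->|[A1 B1] L IH B [k /IH[L' sL' TL']]].
  by exists [::] => // T _ _ q; rewrite !big_nil mulr0 add0r.
exists ((A1 + k *: A, B1) :: L') => [|T TD TZ q]; first by rewrite /= sL'.
rewrite !big_cons /= -TL' // TD TZ mulrBr -scalerAr !mulrDl -!scalerAl.
ncring.
Qed.

Section NoCorner.
Hypothesis nocorner : ~ finite_corner.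

(** An operator that kills the right coefficients of [L] but not [B] turns the given
    map of finite rank into [x |-> A * x * B'] with [B'] nonzero, and this exhibits
    a finite corner unless [A = 0]. *)
Lemma ev_head_eq0 L A B W : ~ spn [seq e.2 | e <- L] B ->
  (forall x, spn W (A * i x * B + ev L (i x))) -> A = 0.
Proof.
move=> /mop_separate[E EB EL] fr; apply: contrapT => A0.
have [u [a [a0 Aua]]] := q_nz A0; have [v [b [b0 Evb]]] := q_nz EB.
apply: nocorner; exists a, b.
exists (flatten [seq [seq 1 * w * (i e.2 * i v) | w <- W] | e <- E]).
split=> // x.
have -> : i a * i x * i b = \sum_(e <- E)
    1 * (A * i (u * x * e.1)%nu * B + ev L (i (u * x * e.1)%nu)) * (i e.2 * i v).
  rewrite -Aua -Evb /mop mulr_suml mulr_sumr.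
  transitivity (\sum_(e <- E) (A * i (u * x * e.1)%nu * B * (i e.2 * i v)) +
      \sum_(l <- L) l.1 * i (u * x)%nu * (mop E l.2) * i v).
    have -> : \sum_(l <- L) l.1 * i (u * x)%nu * mop E l.2 * i v = 0.
      rewrite big_seq big1 // => l lL.
      by rewrite EL ?mulr0 ?mul0r //; apply: map_f.
    by rewrite addr0; apply: eq_bigr => e _; rewrite !cliM !mulrA.
  under [X in _ + X]eq_bigr do rewrite /mop mulr_sumr mulr_suml.
  rewrite exchange_big /= -big_split; apply: eq_bigr => e _.
  rewrite mul1r mulrDl; congr (_ + _); rewrite mulr_suml; apply: eq_bigr => l _.
  by rewrite !cliM !mulrA.
elim: (E) => [|e E' IH]; first by rewrite big_nil; apply: spn0.
rewrite big_cons; apply: spnD; last exact: spn_catr.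
exact/spn_catl/spn_mul.
Qed.

Lemma ev_finite_rank L W : (forall x, spn W (ev L (i x))) ->
  forall x, ev L (i x) = 0.
Proof.
have [n] := ubnP (size L); elim: n L => // n IH [|[A B] L] /= szL fr x.
  by rewrite /ev big_nil.
have [BL|nBL] := pselect (spn [seq e.2 | e <- L] B).
  have [L' sL' eL'] := tensor_absorb A BL.
  have e q : ev ((A, B) :: L) q = ev L' q.
    by have := eL' id (fun _ _ => erefl) (fun _ _ => erefl) q; rewrite ev_cons.
  rewrite e; apply: IH => [|y]; last by rewrite -e.
  by have := congr1 size sL'; rewrite !size_map => ->.
have A0 : A = 0.
  by apply: (ev_head_eq0 nBL (W := W)) => y; have := fr y; rewrite ev_cons.
rewrite ev_cons A0 /= !mul0r add0r; apply: IH => // y.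
by have := fr y; rewrite ev_cons A0 /= !mul0r add0r.
Qed.

End NoCorner.
End Tensor.

(** * Outer derivations and generalized polynomials *)

Section Kharchenko.
Variables (R : nuRingType) (primeR : prime_nuring R) (K : mquotient R).
Variables (d : R -> R) (der_d : derivation d).
Local Notation F := (clF K).
Local Notation Q := (clQ K).
Local Notation i := (@cli R K).
Implicit Types (x y z r s u v : R) (p q A B : Q) (W : seq Q).

Lemma dD x y : d (x + y) = d x + d y.
Proof. by case: der_d => + _; apply. Qed.

Lemma dM x y : d (x * y)%nu = (d x * y)%nu + (x * d y)%nu.
Proof. by case: der_d => _; apply. Qed.

Lemma d0 : d 0 = 0.
Proof. by apply: (addIr (d 0)); rewrite -dD !add0r. Qed.

Lemma dN x : d (- x) = - d x.
Proof. by apply: (addIr (d x)); rewrite -dD !addNr d0. Qed.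

Lemma dB x y : d (x - y) = d x - d y.
Proof. by rewrite dD dN. Qed.

Lemma idM x y : i (d (x * y)%nu) = i (d x) * i y + i x * i (d y).
Proof. by rewrite dM cliD !cliM. Qed.

Definition inner_by (b : Q) := forall x, i (d x) = b * i x - i x * b.

Section Reduction.
Hypothesis nocorner : ~ finite_corner K.

(** If a family of elementary maps whose coefficients depend on [z] through
    [C z e - e z C] has finite rank for every [z], the coefficients cancel and
    the free one, [g z], is itself of that shape. *)
Lemma coboundary (e : R) (g : R -> Q) B (L : seq (Q * Q)) : B <> 0 ->
  (forall z, exists W, forall x, spn W (g z * i x * B +
     \sum_(l <- L) (l.1 * i z * i e - i e * i z * l.1) * i x * l.2)) ->
  exists k : Q, forall z, g z = i e * i z * k - k * i z * i e.
Proof.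
move=> B0; have [n] := ubnP (size L); elim: n L g => // n IH [|[C h] L] g /= szL fr.
  exists 0 => z; rewrite mulr0 !mul0r subrr; have [W frz] := fr z.
  apply: (ev_head_eq0 primeR nocorner (L := [::]) (B := B) (W := W)) => // x.
  by have := frz x; rewrite big_nil /ev big_nil.
pose T z (c : Q) := c * i z * i e - i e * i z * c.
have TD z p q : T z (p + q) = T z p + T z q by rewrite /T; ncring.
have TZ z (k : F) p : T z (k *: p) = k *: T z p.
  by rewrite /T -!scalerAr -!scalerAl -scalerBr.
have [hL|nhL] := pselect (spn [seq l.2 | l <- (0, B) :: L] h).
  have [[|[C' B'] L'] sL' eL'] := tensor_absorb C hL; first by [].
  case: sL' eL' => -> sL' eL'.
  have [||k kP] := IH L' (fun z => g z + T z C').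
  - by move/(congr1 size): sL'; rewrite !size_map => ->.
  - move=> z; have [W frz] := fr z; exists W => x; have := frz x.
    have := eL' (T z) (TD z) (TZ z) (i x); rewrite !big_cons /= -!/(T z _).
    have -> : T z 0 = 0 by rewrite /T; ncring.
    rewrite !mul0r add0r => ->; rewrite [(g z + _) * _]mulrDl.
    by rewrite [(_ + _) * B]mulrDl -addrA.
  exists (k + C') => z; move: (kP z) => /(canRL (addrK _)) ->.
  by rewrite /T; ncring.
pose M z := (g z, B) :: [seq (T z l.1, l.2) | l <- L].
have evM z x : ev (M z) (i x) = g z * i x * B +
    \sum_(l <- L) T z l.1 * i x * l.2 by rewrite ev_cons /ev big_map.
have TC z : T z C = 0.
  have [W frz] := fr z.
  apply: (ev_head_eq0 primeR nocorner (L := M z) (B := h) (W := W)) => [|x].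
    by rewrite /M /= -map_comp.
  by have := frz x; rewrite big_cons /= -!/(T z _) evM addrCA.
apply: (IH L) => // z; have [W frz] := fr z; exists W => x.
by have := frz x; rewrite big_cons /= -!/(T z _) TC !mul0r add0r.
Qed.

Hypothesis outer : ~ exists b, inner_by b.

(** The identity makes [r * e * s |-> d (r * e) * s - r * k * s] a well-defined
    right-linear map; it is the multiplication by some [b], and [d] is the inner
    derivation given by [b]. *)
Lemma outer_no_coboundary (e : R) : e <> 0 ->
  ~ exists k : Q, forall z, i e * i (d (z * e)%nu) = i e * i z * k - k * i z * i e.
Proof.
move=> e0 [k kP]; apply: outer.
have kdom : large (fun x => exists y, k * i x = i y) by apply: cl_dom.
pose term (l : R * R) : Q := (i (d (l.1 * e)%nu) - i l.1 * k) * i l.2.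
pose arg (l : R * R) : Q := i (l.1 * e * l.2)%nu.
pose G X Y := exists l : seq (R * R),
  i X = \sum_(j <- l) arg j /\ i Y = \sum_(j <- l) term j.
have Gfun Y : G 0 Y -> Y = 0.
  move=> [l [h1 h2]]; apply: (@cli_inj _ K).
  apply: (prime_i primeR e0) => z.
  have -> : i e * i z * i Y = - (k * i z + i e * i (d z)) * i 0.
    rewrite h1 h2 !mulr_sumr; apply: eq_bigr => -[r s] _.
    rewrite /term /arg /= !cliM; have := kP (z * r)%nu.
    rewrite -numulA idM !cliM mulrDr => /(canRL (addKr _)) h.
    transitivity ((i e * (i z * i (d (r * e)%nu)) - i e * (i z * i r) * k) * i s).
      by ncring.
    by rewrite h; ncring.
  by rewrite i0 mulr0.
have Gdom : large (fun X => exists2 s, (exists y, k * i s = i y) &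
    exists r, X = (r * e * s)%nu).
  have [a a0 ka] := kdom; have [t c0] := prime_sep primeR e0 a0.
  exists (e * t * a)%nu => // r s; exists (t * a * s)%nu; first exact: ka.
  by exists r; rewrite !numulA.
have Gin r s y : k * i s = i y ->
    G (r * e * s)%nu ((d (r * e) * s)%nu - (r * y)%nu).
  move=> ksy; exists [:: (r, s)]; rewrite !big_seq1; split=> //.
  by rewrite /term /= iB !cliM -ksy; ncring.
have [|b bP] := @cl_lift _ K G.
  split=> //.
  - move=> x y x' y' [l [h1 h2]] [l' [h1' h2']].
    exists (l ++ [seq (- j.1, j.2) | j <- l']); rewrite !big_cat !big_map.
    rewrite !iB h1 h1' h2 h2' -!sumrN; split; congr (_ + _).
      by apply: eq_bigr => j _; rewrite /arg /= !cliM iN; ncring.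
    by apply: eq_bigr => j _; rewrite /term /= nuNr dN !iN; ncring.
  - move=> x y r [l [h1 h2]]; exists [seq (j.1, (j.2 * r)%nu) | j <- l].
    rewrite !big_map !cliM h1 h2 !mulr_suml; split; apply: eq_bigr => j _.
      by rewrite /arg /= !cliM; ncring.
    by rewrite /term /= !cliM; ncring.
  - apply: large_imp Gdom => _ [s [y ksy] [r ->]].
    by exists ((d (r * e) * s)%nu - (r * y)%nu); apply: Gin.
exists b => x; apply/eqP; rewrite -subr_eq0; apply/eqP; apply: cl_faith.
apply: large_imp Gdom => _ [s [y ksy] [r ->]].
have h1 := bP _ _ (Gin r s y ksy); have := bP _ _ (Gin (x * r)%nu s y ksy).
rewrite -!numulA !cliM => h2.
transitivity (i (d x) * (i r * (i e * i s)) - (b * (i x * (i r * (i e * i s)))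
  - i x * (b * i (r * e * s)%nu))); first by rewrite !cliM; ncring.
rewrite h2 h1 !iB !cliM idM !cliM; ncring.
Qed.

(** In a ring without finite corners an outer derivation behaves as an
    independent variable: the terms containing [d x] in an identity of finite
    rank cancel by themselves. *)
Lemma outer_der_part (L0 L1 : seq (Q * Q)) W :
  (forall x, spn W (ev L0 (i x) + ev L1 (i (d x)))) ->
  forall x, ev L1 (i (d x)) = 0.
Proof.
have [n] := ubnP (size L1); elim: n L1 => // n IH [|[A B] L1] /= szL fr x.
  by rewrite /ev big_nil.
have [BL|nBL] := pselect (spn [seq e.2 | e <- L1] B).
  have [L' sL' eL'] := tensor_absorb A BL.
  have e q : ev ((A, B) :: L1) q = ev L' q.
    by have := eL' id (fun _ _ => erefl) (fun _ _ => erefl) q; rewrite ev_cons.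
  rewrite e; apply: IH => [|y]; last by rewrite -e.
  by have := congr1 size sL'; rewrite !size_map => ->.
suff A0 : A = 0.
  rewrite ev_cons A0 /= !mul0r add0r; apply: IH => // y.
  by have := fr y; rewrite ev_cons A0 /= !mul0r add0r.
have [E EB EL] := mop_separate primeR nBL; apply: contrapT => A0.
have [u [e [e0 Aue]]] := q_nz A0.
(* [E] isolates the term [A * d x * B] among those containing [d x]. *)
have [L2 [W2 fr2]] : exists L2 W2, forall x,
    spn W2 (ev L2 (i x) + A * i (d x) * mop E B).
  have [M ME] : exists M, M = (A, B) :: L1 by exists ((A, B) :: L1).
  rewrite -ME in fr.
  exists (flatten [seq [seq (l.1, i e.1 * l.2 * i e.2) | l <- L0] ++
     [seq (l.1, i (d e.1) * l.2 * i e.2) | l <- M] | e <- E]).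
  exists (flatten [seq [seq 1 * w * i e.2 | w <- W] | e <- E]) => y.
  have -> : A * i (d y) * mop E B =
     \sum_(e <- E) \sum_(l <- M) l.1 * i (d y) * (i e.1 * l.2 * i e.2).
    rewrite ME exchange_big big_cons /=.
    have -> : \sum_(l <- L1) \sum_(e <- E)
        l.1 * i (d y) * (i e.1 * l.2 * i e.2) = 0.
      rewrite big_seq big1 // => l lL.
      by rewrite -mulr_sumr -/(mop E l.2) EL ?mulr0 //; apply: map_f.
    by rewrite addr0 -mulr_sumr.
  elim: (E) => [|e' E' IHE]; first by rewrite /ev !big_nil addr0; apply: spn0.
  rewrite /= ev_cat big_cons addrACA; apply: spnD; last exact: spn_catr.
  apply: spn_catl.
  have := spn_mul 1 (i e'.2) (fr (y * e'.1)%nu); apply: spn_cong.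
  rewrite mul1r mulrDl !ev_mulr idM cliM ev_cat -addrA; congr (_ + _).
    by rewrite /ev !big_map; apply: eq_bigr => l _ /=; rewrite !mulrA.
  rewrite [RHS]addrC /ev !big_map -big_split; apply: eq_bigr => l _ /=.
  by rewrite mulrDr mulrDl; ncring.
(* now the left coefficient is replaced by an element [e] of [R] *)
have [L3 [W3 fr3]] : exists L3 W3, forall x,
    spn W3 (ev L3 (i x) + i e * i (d x) * mop E B).
  exists ((A * i (d u), mop E B) :: [seq (l.1 * i u, 1 * l.2) | l <- L2]), W2 => y.
  rewrite ev_cons -ev_arg mulr1 /= -Aue; have := fr2 (u * y)%nu.
  by rewrite idM cliM; apply: spn_cong; ncring.
(* subtracting [e * z] times the value at [y] from the value at [z * e * y]
   removes [d y] and leaves [e * d (z * e) * y] *)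
apply: (outer_no_coboundary e0).
apply: (coboundary EB (L := L3)) => z.
exists (W3 ++ [seq (i e * i z) * w * 1 | w <- W3]) => y.
have h1 := spn_catl [seq (i e * i z) * w * 1 | w <- W3] (fr3 (z * e * y)%nu).
have h2 := spn_catr W3 (spn_mul (i e * i z) 1 (fr3 y)).
have := spnB h1 h2; apply: spn_cong.
rewrite [d (_ * _)%nu]dM mulr1 cliD !cliM.
have -> : ev L3 (i z * i e * i y) =
    ev [seq (l.1 * (i z * i e), 1 * l.2) | l <- L3] (i y).
  by rewrite -ev_arg mulr1.
transitivity (ev [seq (l.1 * (i z * i e), 1 * l.2) | l <- L3] (i y)
   - i e * i z * ev L3 (i y) + i e * i (d (z * e)%nu) * i y * mop E B).
  by ncring.
rewrite ev_mull addrC; congr (_ + _).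
rewrite /ev !big_map -sumrB; apply: eq_bigr => l _.
by rewrite /=; ncring.
Qed.

End Reduction.
End Kharchenko.

(** * Polarization *)

Section Splits.
Variable T : eqType.
Implicit Types (x : T) (s t : seq T).

Fixpoint splits s : seq (T * seq T) :=
  if s is x :: s' then (x, s') :: [seq (p.1, x :: p.2) | p <- splits s'] else [::].

Lemma splits_cat s t : splits (s ++ t) =
  [seq (p.1, p.2 ++ t) | p <- splits s] ++ [seq (p.1, s ++ p.2) | p <- splits t].
Proof.
elim: s => /= [|x s ->].
  by rewrite -[LHS]map_id; apply: eq_map => -[].
by congr (_ :: _); rewrite map_cat -!map_comp.
Qed.

Lemma splits_perm s p : p \in splits s -> perm_eq (p.1 :: p.2) s.
Proof.
elim: s p => //= x s IH p; rewrite inE => /orP[/eqP->|/mapP[q /IH h ->]] //=.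
by rewrite -cat1s -[x :: q.2]cat1s perm_catCA /= perm_cons.
Qed.

Lemma splits_size s p : p \in splits s -> size s = (size p.2).+1.
Proof. by move/splits_perm/perm_size. Qed.

Definition subperm t s := exists r, perm_eq (t ++ r) s.

Lemma subperm_mid t1 t2 x s : subperm (t1 ++ x :: t2) (x :: s) -> subperm (t1 ++ t2) s.
Proof.
move=> [r h]; exists r; rewrite -(perm_cons x); apply: perm_trans h.
by rewrite -!catA /= -cat1s perm_catCA.
Qed.

Lemma subperm_notin t x s : x \notin t -> subperm t (x :: s) -> subperm t s.
Proof.
move=> xt [r h]; have : x \in t ++ r by rewrite (perm_mem h) inE eqxx.
rewrite mem_cat (negPf xt) /= => /path.splitPr rE; case: rE h => r1 r2 h.
exists (r1 ++ r2); rewrite catA.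
have [r' h'] : subperm ((t ++ r1) ++ r2) s.
  by apply: (@subperm_mid _ _ x); exists [::]; rewrite cats0 -catA.
have sz : size r' = 0%N.
  move: (perm_size h) (perm_size h'); rewrite !size_cat /= !addnS !addnA.
  by case=> <- /eqP; rewrite -[X in _ == X]addn0 eqn_add2l => /eqP.
by move: h'; rewrite (size0nil sz) cats0.
Qed.

End Splits.

Section Polarization.
Variables (R : zmodType) (Q : nzRingType).
Implicit Types (f B : R -> Q) (s : seq R).

(** When [size s = n], the sum of the products of the values of [B] at the entries
    of [s] over all [n!] orders, organized by the last factor. *)
Fixpoint sym_prod B n s : Q :=
  if n is n'.+1 then \sum_(p <- splits s) sym_prod B n' p.2 * B p.1 else 1.

(** The iterated difference of [f] at [y] with increments [s]. *)
Fixpoint delta f s y : Q :=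
  if s is x :: s' then delta f s' (y + x) - delta f s' y else f y.

Lemma eq_delta f g s y : f =1 g -> delta f s y = delta g s y.
Proof. by move=> fg; elim: s y => /= [y|x s IH y]; rewrite ?fg ?IH. Qed.

Lemma delta_mull c f s y : delta (fun y => c * f y) s y = c * delta f s y.
Proof. by elim: s y => //= x s IH y; rewrite !IH mulrBr. Qed.

Lemma delta_const c s y : s <> [::] -> delta (fun=> c) s y = 0.
Proof.
elim: s y => // x [|x' s] IH y _ /=; first by rewrite subrr.
by rewrite -!/(delta _ (x' :: s) _) !IH ?subrr.
Qed.

Lemma delta_mulr f B s y : {morph B : x y / x + y} ->
  delta (fun y => f y * B y) s y = delta f s y * B (y + \sum_(x <- s) x) +
    \sum_(p <- splits s) delta f p.2 y * B p.1.
Proof.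
move=> BD; elim: s y => [|x s IH] y /=; first by rewrite !big_nil !addr0.
rewrite !IH !big_cons big_map /=.
have -> : \sum_(p <- splits s) (delta f p.2 (y + x) - delta f p.2 y) * B p.1 =
    \sum_(p <- splits s) delta f p.2 (y + x) * B p.1 -
    \sum_(p <- splits s) delta f p.2 y * B p.1.
  by rewrite -sumrB; apply: eq_bigr => p _; rewrite mulrBl.
rewrite !BD; ncring.
Qed.

Lemma delta_exp B n s y : {morph B : x y / x + y} ->
  (size s = n -> delta (fun y => B y ^+ n) s y = sym_prod B n s) /\
  ((n < size s)%N -> delta (fun y => B y ^+ n) s y = 0).
Proof.
move=> BD; elim: n s => [|n IH] s.
  split=> [|s0]; first by case: s.
  by rewrite (eq_delta _ _ (fun y => expr0 (B y))) delta_const //; case: s s0.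
rewrite (eq_delta _ _ (fun y => exprSr (B y) n)) delta_mulr //; split=> szs.
  rewrite (IH s).2 ?szs // mul0r add0r; apply: eq_big_seq => p /splits_size.
  by rewrite szs => -[/esym/(IH p.2).1 ->].
rewrite (IH s).2 ?(ltnW szs) // mul0r add0r big_seq big1 // => p /splits_size.
by move=> szp; rewrite (IH p.2).2 ?mul0r // -ltnS -szp.
Qed.

(** The full linearization of [B y ^+ n = c * A y ^+ n]. *)
Lemma polarize A B c n : {morph A : x y / x + y} -> {morph B : x y / x + y} ->
  (forall y, B y ^+ n = c * A y ^+ n) ->
  forall s, size s = n -> sym_prod B n s = c * sym_prod A n s.
Proof.
move=> AD BD h s szs; rewrite -((delta_exp n s 0 BD).1 szs).
by rewrite (eq_delta _ _ h) delta_mull (delta_exp n s 0 AD).1.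
Qed.

Definition pos_additive k (P : seq R -> Q) := forall s1 x y s2,
  (size s1 + size s2).+1 = k ->
  P (s1 ++ (x + y) :: s2) = P (s1 ++ x :: s2) + P (s1 ++ y :: s2).

Lemma sym_prod_additive B n : {morph B : x y / x + y} -> pos_additive n (sym_prod B n).
Proof.
move=> BD; elim: n => [|n IH] s1 x y s2 //= [szs].
rewrite !splits_cat /= !big_cat !big_cons !big_map /= BD.
pose S1 z := \sum_(p <- splits s1) sym_prod B n (p.2 ++ z :: s2) * B p.1.
pose S2 z := \sum_(p <- splits s2) sym_prod B n (s1 ++ z :: p.2) * B p.1.
have S1D : S1 (x + y) = S1 x + S1 y.
  rewrite -big_split; apply: eq_big_seq => p /splits_size szp /=.
  by rewrite IH ?mulrDl // -addSn -szp.
have S2D : S2 (x + y) = S2 x + S2 y.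
  rewrite -big_split; apply: eq_big_seq => p /splits_size szp /=.
  by rewrite IH ?mulrDl // -addnS -szp.
rewrite -/(S1 _) -/(S1 _) -/(S1 _) -/(S2 _) -/(S2 _) -/(S2 _) S1D S2D.
by ncring.
Qed.

End Polarization.

(** * Comparing coefficients in symmetrized products *)

Section Separation.
Variables (R : nuRingType) (primeR : prime_nuring R) (K : mquotient R).
Local Notation F := (clF K).
Local Notation Q := (clQ K).
Local Notation i := (@cli R K).
Variable U : R -> Q.
Hypothesis UD : {morph U : x y / x + y}.
Implicit Types (x y z : R) (p q A B : Q) (W : seq Q) (s t : seq R).
Implicit Types (L : seq (R -> Q)) (C : seq Q).

Definition elementary (f : R -> Q) :=
  exists L0 L1 : seq (Q * Q), forall x, f x = ev L0 (i x) + ev L1 (U x).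

(* [U] is either the derivation, if it is outer, or zero; these two properties are
   what the absence of finite corners gives in both cases. *)
Hypothesis finite_rank0 : forall f W, elementary f -> (forall x, spn W (f x)) ->
  forall x, f x = 0.
Hypothesis head_eq0 : forall A B (L0 L1 : seq (Q * Q)), ~ spn [seq e.2 | e <- L0] B ->
  (forall x, A * i x * B + ev L0 (i x) + ev L1 (U x) = 0) -> A = 0.

Lemma elementary_add f : elementary f -> {morph f : x y / x + y}.
Proof.
move=> [L0 [L1 fE]] x y; rewrite !fE cliD UD !evD; ncring.
Qed.

Lemma elementary_mulr f p : elementary f -> elementary (fun x => f x * p).
Proof.
move=> [L0 [L1 fE]]; exists [seq (e.1, e.2 * p) | e <- L0].
exists [seq (e.1, e.2 * p) | e <- L1].
by move=> x; rewrite fE mulrDl !ev_mulr.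
Qed.

Lemma elementary_mull f p : elementary f -> elementary (fun x => p * f x).
Proof.
move=> [L0 [L1 fE]]; exists [seq (p * e.1, e.2) | e <- L0].
exists [seq (p * e.1, e.2) | e <- L1].
by move=> x; rewrite fE mulrDr !ev_mull.
Qed.

Lemma elementaryD f g : elementary f -> elementary g ->
  elementary (fun x => f x + g x).
Proof.
move=> [L0 [L1 fE]] [M0 [M1 gE]]; exists (L0 ++ M0), (L1 ++ M1).
by move=> x; rewrite fE gE !ev_cat; ncring.
Qed.

Lemma elementary_lc V a : alls elementary V -> elementary (fun z => lc a (evl V z)).
Proof.
elim: V a => /= [a _|f V IH a [[L0 [L1 fE]] /(IH (fun j => a j.+1)) EV]].
  by exists [::], [::] => x; rewrite /ev !big_nil addr0.
apply: elementaryD EV; exists [seq (a 0%N *: e.1, e.2) | e <- L0].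
exists [seq (a 0%N *: e.1, e.2) | e <- L1] => x.
by rewrite fE scalerDr !evZ.
Qed.

Lemma alls_mem (P : (R -> Q) -> Prop) V : (forall f, f \in V -> P f) -> alls P V.
Proof.
elim: V => //= f V IH h; split; first by apply: h; rewrite inE eqxx.
by apply: IH => g gV; apply: h; rewrite inE gV orbT.
Qed.

(** All values of nonempty words [l1 x1 * ... * lm xm * c] with letters
    [l1, ..., lm] in [L], final coefficient [c] in [C], and entries
    [x1, ..., xm] taken from distinct places of [s], in any order. The recursion
    uses up [s] from the left, so that each entry can be chosen in general position
    with respect to the words in the entries before it. *)
Fixpoint words L C s : seq Q :=
  if s is x :: s' then
    [seq l x * c | l <- L, c <- C] ++
    words (L ++ [seq (fun y => l x * l' y) | l <- L, l' <- L])
          (C ++ [seq l x * c | l <- L, c <- C]) s'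
  else [::].

Definition word (m : seq ((R -> Q) * R)) : Q := \prod_(e <- m) e.1 e.2.

(** There are four cases for the first entry [x] of [s]: it is absent from the
    word, it is the whole word, it is last and goes into the final coefficient, or
    its letter is merged with the next one. *)
Lemma mem_words L C s m c : m <> [::] -> (forall e, e \in m -> e.1 \in L) ->
  c \in C -> subperm [seq e.2 | e <- m] s -> word m * c \in words L C s.
Proof.
elim: s L C m c => [|x s IH] L C m c m0 mL cC sm.
  by case: sm => r /perm_size; case: m m0 {mL}.
rewrite /= mem_cat.
have [/mapP[e em xe]|xm] := boolP (x \in [seq e.2 | e <- m]); last first.
  apply/orP; right; apply: IH => //; last exact: subperm_notin sm.
    by move=> e /mL; rewrite mem_cat => ->.
  by rewrite mem_cat cC.
case/path.splitPr: em m0 mL sm => m1 m2 _ mL sm.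
have eL : e.1 \in L by apply: mL; rewrite mem_cat inE eqxx orbT.
have m1L e' : e' \in m1 -> e'.1 \in L by move=> h; apply: mL; rewrite mem_cat h.
have {}sm : subperm [seq e'.2 | e' <- m1 ++ m2] s.
  by move: sm; rewrite !map_cat /= -xe => /subperm_mid.
have lxc l c' : l \in L -> c' \in C -> l x * c' \in [seq l x * c | l <- L, c <- C].
  by move=> lL c'C; apply/allpairsP; exists (l, c').
case: m2 mL sm => [|e2 m2] mL sm.
  have -> : word (m1 ++ [:: e]) * c = word m1 * (e.1 x * c).
    by rewrite /word big_cat big_seq1 /= -xe mulrA.
  case: m1 m1L sm {mL} => [|e1 m1] m1L sm.
    by rewrite /word big_nil mul1r lxc.
  apply/orP; right; apply: IH => //; last by rewrite cats0 in sm.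
    by move=> e' /m1L; rewrite mem_cat => ->.
  by rewrite mem_cat lxc ?orbT.
have e2L : e2.1 \in L by apply: mL; rewrite mem_cat !inE eqxx !orbT.
apply/orP; right.
have -> : word (m1 ++ e :: e2 :: m2) =
    word (m1 ++ (fun y => e.1 x * e2.1 y, e2.2) :: m2).
  by rewrite /word !big_cat !big_cons /= -xe !mulrA.
apply: IH => //; [by case: (m1) | | by rewrite mem_cat cC |].
- move=> e'; rewrite mem_cat inE => /or3P[/m1L|/eqP->|e'm2].
  + by rewrite mem_cat => ->.
  + by rewrite mem_cat; apply/orP; right; apply/allpairsP; exists (e.1, e2.1).
  + by rewrite mem_cat mL // mem_cat !inE e'm2 !orbT.
- by move: sm; rewrite !map_cat.
Qed.

(** The entries are chosen one at a time: once [x] is fixed, a word through [x]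
    and other entries becomes a shorter word with new letters, and the words
    through [x] alone are avoided because [x] is generic. *)
Lemma avoid_words k L C W (P : seq R -> Q) c : (forall l, l \in L -> elementary l) ->
  pos_additive k P -> (exists2 s, size s = k & P s <> 0) -> ~ spn W c ->
  exists s, [/\ size s = k, P s <> 0 & ~ spn (words L C s ++ W) c].
Proof.
elim: k L C W P => [|k IH] L C W P EL PD [s0 szs0 P0] nc.
  by exists s0; case: s0 szs0 P0.
case: s0 szs0 P0 => // x0 s0 [szs0] P0.
pose V := [seq (fun x => l x * c') | l <- L, c' <- C].
have [x Px nx] : exists2 x, P (x :: s0) <> 0 & ~ spn (evl V x ++ W) c.
  apply: (@generic_avoid _ _ _ elementary elementary_add elementary_lc
    finite_rank0 _ (fun x => P (x :: s0)) x0) => //.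
    by apply: alls_mem => f /allpairsP[[l c'] [/EL h _ ->]]; apply: elementary_mulr.
  by move=> y z; rewrite (PD [::]) //= szs0.
have evV : evl V x = [seq l x * c | l <- L, c <- C].
  by rewrite /evl /V map_allpairs.
have [|s1 x1 y1 s2 [sz]|||s [szs Ps ns]] := IH
    (L ++ [seq (fun y => l x * l' y) | l <- L, l' <- L])
    (C ++ [seq l x * c | l <- L, c <- C]) (evl V x ++ W) (fun s => P (x :: s)).
- move=> l; rewrite mem_cat => /orP[/EL//|/allpairsP[[l1 l2] [_ /EL h ->]]].
  exact: elementary_mull.
- by rewrite (PD (x :: s1)) //= addSn sz.
- by exists s0.
- exact: nx.
exists (x :: s); split=> //=; first by rewrite szs.
move=> h; apply: ns; apply: spn_subset h => w; rewrite evV !mem_cat.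
by case/orP => [/orP[]|] ->; rewrite ?orbT.
Qed.

Definition lin_in (S : Q -> Prop) (f : R -> Q) := exists L0 L1 : seq (Q * Q),
  (forall x, f x = ev L0 (i x) + ev L1 (U x)) /\ forall e, e \in L0 -> S e.2.

Lemma lin_inD S f g : lin_in S f -> lin_in S g -> lin_in S (fun x => f x + g x).
Proof.
move=> [L0 [L1 [fE fS]]] [M0 [M1 [gE gS]]]; exists (L0 ++ M0), (L1 ++ M1).
split=> [x|e]; first by rewrite fE gE !ev_cat; ncring.
by rewrite mem_cat => /orP[/fS|/gS].
Qed.

Lemma lin_in_sum S (T : eqType) (r : seq T) (f : T -> R -> Q) :
  (forall j, j \in r -> lin_in S (f j)) -> lin_in S (fun x => \sum_(j <- r) f j x).
Proof.
elim: r => [_|j r IH h].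
  by exists [::], [::]; split=> // x; rewrite big_nil /ev !big_nil addr0.
have hr : lin_in S (fun x => \sum_(j <- r) f j x).
  by apply: IH => j' jr; apply: h; rewrite inE jr orbT.
have [|L0 [L1 [hE hS]]] := lin_inD (h j _) hr; first by rewrite inE eqxx.
by exists L0, L1; split=> // x; rewrite big_cons hE.
Qed.

Lemma lin_in_mull S f p : lin_in S f -> lin_in S (fun x => p * f x).
Proof.
move=> [L0 [L1 [fE fS]]]; exists [seq (p * e.1, e.2) | e <- L0].
exists [seq (p * e.1, e.2) | e <- L1].
by split=> [x|e /mapP[e' /fS h ->]] //; rewrite fE mulrDr !ev_mull.
Qed.

Lemma lin_in_mulr S S' f p : (forall w, S w -> S' (w * p)) ->
  lin_in S f -> lin_in S' (fun x => f x * p).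
Proof.
move=> SS' [L0 [L1 [fE fS]]]; exists [seq (e.1, e.2 * p) | e <- L0].
exists [seq (e.1, e.2 * p) | e <- L1].
by split=> [x|e /mapP[e' /fS/SS' h ->]] //; rewrite fE mulrDl !ev_mulr.
Qed.

(** [w] may precede a final letter: followed by [i y] or [U y] it is a word
    whose other entries come from [s]. *)
Definition prefix_in L s w := forall l, l = i \/ l = U ->
  exists m l', [/\ forall e, e \in m -> e.1 \in L, subperm [seq e.2 | e <- m] s,
    l' \in L & forall y, w * l y = word m * l' y].

(** The condition on coefficients under which they can be compared: as a function of
    its first entry, each is elementary, and what stands to the right of that entry
    is the beginning of a word in the other entries. *)
Definition tame L k (h : seq R -> Q) := pos_additive k h /\
  forall s, (size s).+1 = k -> lin_in (prefix_in L s) (fun x => h (x :: s)).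

(** If the coefficient [h1 s] were nonzero for some [s], it would be for some
    [s] whose words do not span [p1]; in the identity for [x :: s], viewed as an
    identity in [x], it is the coefficient of [p1], so it vanishes. *)
Lemma sym_coef_eq0 L k (h1 h2 h3 : seq R -> Q) (p1 p2 p3 : Q) :
  (forall l, l \in L -> elementary l) ->
  tame L k h1 -> tame L k h2 -> tame L k h3 -> ~ spn [:: p2] p1 ->
  (forall s, size s = k.+1 -> \sum_(q <- splits s)
     (h1 q.2 * i q.1 * p1 + h2 q.2 * i q.1 * p2 + h3 q.2 * U q.1 * p3) = 0) ->
  forall s, size s = k -> h1 s = 0.
Proof.
move=> EL [h1D h1l] [_ h2l] [_ h3l] np1 sum0 s0 szs0; apply: contrapT => hs0.
have [|s [szs hs ns]] := avoid_words [:: p1; p2; p3] EL h1D _ np1.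
  by exists s0.
set C := [:: p1; p2; p3] in ns.
have pre (h : seq R -> Q) (l : R -> Q) c : l = i \/ l = U -> c \in C ->
    (forall s, (size s).+1 = k -> lin_in (prefix_in L s) (fun x => h (x :: s))) ->
    forall j, j \in splits s ->
    lin_in (fun w => w \in words L C s) (fun x => h (x :: j.2) * l j.1 * c).
  move=> lP cC hl j js.
  have szq : (size j.2).+1 = k by rewrite -szs (splits_size js).
  have := @lin_in_mulr _ (fun w => w \in words L C s) _ (l j.1 * c) _ (hl _ szq).
  case=> [w|L0 [L1 [hE hS]]]; last by exists L0, L1; split=> // x; rewrite -hE mulrA.
  move=> /(_ l lP)[m [l' [mL sm l'L wE]]].
  rewrite mulrA wE.
  have -> : word m * l' j.1 * c = word (m ++ [:: (l', j.1)]) * c.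
    by rewrite /word big_cat big_seq1.
  apply: mem_words => //; first by case: (m).
    by move=> e; rewrite mem_cat inE => /orP[/mL|/eqP->].
  case: sm => r hr; exists r; apply: perm_trans (splits_perm js).
  by rewrite map_cat -catA perm_catCA /= perm_cons.
have [|L0 [L1 [sE sS]]] := @lin_in_sum (fun w => w \in words L C s) _ (splits s)
    (fun j x => h1 (x :: j.2) * i j.1 * p1 + h2 (x :: j.2) * i j.1 * p2
       + h3 (x :: j.2) * U j.1 * p3).
  move=> j js; do 2 ?apply: lin_inD; apply: pre => //; rewrite ?inE ?eqxx ?orbT //;
    by [left | right].
apply: hs; apply: (@head_eq0 _ p1 ((h2 s, p2) :: L0) ((h3 s, p3) :: L1)).
  move=> h; apply: ns; apply: spn_subset h => w.
  rewrite /= inE mem_cat => /orP[/eqP->|/mapP[e /sS we ->]]; last by rewrite we.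
  by rewrite inE eqxx orbT.
move=> x; have := sum0 (x :: s); rewrite /= szs big_cons big_map /= => /(_ erefl).
by rewrite sE !ev_cons => <-; ncring.
Qed.

End Separation.

(** * Rings without finite corners *)

Section SymProdTame.
Variables (R : nuRingType) (primeR : prime_nuring R) (K : mquotient R).
Local Notation F := (clF K).
Local Notation Q := (clQ K).
Local Notation i := (@cli R K).
Variables (U B A : R -> Q) (Ys Xs : seq Q).
Hypothesis UD : {morph U : x y / x + y}.
Hypotheses (Ys1 : 1 \in Ys) (Xs1 : 1 \in Xs).

(** The letters of the words that occur when a symmetrized product of values of
    [B] or [A], multiplied on the right by an element of [Xs], is expanded
    around one of its entries. *)
Definition sym_letters : seq (R -> Q) :=
  [seq (fun y => z * f y) | z <- [seq p * X | p <- Ys, X <- Xs],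
                            f <- [:: i; U; B; A]].

Let sym_lettersP p X f : p \in Ys -> X \in Xs -> f \in [:: i; U; B; A] ->
  (fun y => p * X * f y) \in sym_letters.
Proof.
move=> pY XX fA; apply/allpairsP; exists (p * X, f); split=> //=.
by apply/allpairsP; exists (p, X).
Qed.

Let iE : elementary U i.
Proof.
exists [:: (1, 1)], [::] => x.
by rewrite /ev big_seq1 big_nil /= mul1r mulr1 addr0.
Qed.

Let UE : elementary U U.
Proof.
exists [::], [:: (1, 1)] => x.
by rewrite /ev big_seq1 big_nil /= mul1r mulr1 add0r.
Qed.

Lemma lin_in_elementary S (f : R -> Q) : lin_in U S f -> elementary U f.
Proof. by move=> [L0 [L1 [fE _]]]; exists L0, L1. Qed.

Hypotheses (Blin : lin_in U (fun w => w \in Ys) B).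
Hypotheses (Alin : lin_in U (fun w => w \in Ys) A).

Lemma sym_letters_elementary l : l \in sym_letters -> elementary U l.
Proof.
move=> /allpairsP[[z f] [_ /= fA ->]]; apply: elementary_mull.
move: fA; rewrite !inE => /or4P[] /eqP->; [exact: iE|exact: UE| |].
  exact: lin_in_elementary Blin.
exact: lin_in_elementary Alin.
Qed.

Section OneFactor.
Variables (G : R -> Q).
Hypotheses (GA : G \in [:: i; U; B; A]) (Glin : lin_in U (fun w => w \in Ys) G).

Let prefixG s w := exists p t,
  [/\ p \in Ys, subperm t s & w = p * \prod_(y <- t) G y].

(** In each of the products only factors [G y] stand to the right of the factor of
    [x], apart from a right coefficient of [G] itself. *)
Lemma sym_prod_lin k s : size s = k ->
  lin_in U (prefixG s) (fun x => sym_prod G k.+1 (x :: s)).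
Proof.
have GlinS t : lin_in U (prefixG t) G.
  have [L0 [L1 [GE GY]]] := Glin; exists L0, L1; split=> // e /GY eY.
  by exists e.2, [::]; split; [|exists t|rewrite big_nil mulr1].
elim: k s => [|k IH] s szs.
  have -> : (fun x => sym_prod G 1 (x :: s)) = G; last exact: GlinS.
  by apply/funext => x; rewrite (size0nil szs) /= big_seq1 mul1r.
have -> : (fun x => sym_prod G k.+2 (x :: s)) = (fun x => sym_prod G k.+1 s * G x +
    \sum_(j <- splits s) sym_prod G k.+1 (x :: j.2) * G j.1).
  by apply/funext => x; rewrite [LHS]/= big_cons big_map.
apply: lin_inD; first exact: lin_in_mull.
apply: lin_in_sum => j js.
have [|L0 [L1 [jE jS]]] := IH j.2; first by move: szs; rewrite (splits_size js) => -[].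
apply: (@lin_in_mulr _ _ _ (prefixG j.2)); last by exists L0, L1.
move=> w [p [t [pY [r tr] ->]]]; exists p, (t ++ [:: j.1]); split=> //.
  exists r; apply: perm_trans (splits_perm js).
  by rewrite -catA perm_catCA /= perm_cons.
by rewrite big_cat big_seq1 /= mulrA.
Qed.

Lemma sym_prod_tame k X : X \in Xs ->
  tame U sym_letters k (fun s => sym_prod G k s * X).
Proof.
have [L0 [L1 [GE GY]]] := Glin.
have GD : {morph G : x y / x + y}.
  by apply: (elementary_add UD); exists L0, L1.
move=> XX; split.
  by move=> s1 x y s2 sz; rewrite (sym_prod_additive GD) // mulrDl.
move=> s szs; have := sym_prod_lin (erefl (size s)); rewrite szs => sl.
apply: lin_in_mulr sl => _ [p [t [pY [r tr] ->]]] l lP.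
have lA : l \in [:: i; U; B; A] by rewrite !inE; case: lP => ->; rewrite eqxx ?orbT.
case: t tr => [|y0 t] tr.
  exists [::], (fun y => p * X * l y); split=> //.
  - by exists s.
  - exact: sym_lettersP.
  - by move=> y; rewrite /word !big_nil mul1r mulr1.
exists ((fun y => p * 1 * G y, y0) :: [seq (fun y => 1 * 1 * G y, y) | y <- t]).
exists (fun y => 1 * X * l y); split.
- move=> e; rewrite inE => /orP[/eqP->|/mapP[y _ ->]]; exact: sym_lettersP.
- by exists r; rewrite /= -map_comp map_id.
- exact: sym_lettersP.
- move=> y; rewrite /word !big_cons big_map /= mulr1 !mul1r.
  under [X in _ = _ * X * _]eq_bigr do rewrite !mul1r.
  by rewrite !mulrA.
Qed.

End OneFactor.

Lemma tameD L k (h h' : seq R -> Q) : tame U L k h -> tame U L k h' ->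
  tame U L k (fun s => h s + h' s).
Proof.
move=> [hD hl] [hD' hl']; split=> [s1 x y s2 sz|s szs].
  by rewrite hD // hD' //; ncring.
by apply: lin_inD; [exact: hl|exact: hl'].
Qed.

Lemma tame_mull L k (h : seq R -> Q) p : tame U L k h ->
  tame U L k (fun s => p * h s).
Proof.
move=> [hD hl]; split=> [s1 x y s2 sz|s szs]; first by rewrite hD // mulrDr.
by apply: lin_in_mull; apply: hl.
Qed.

End SymProdTame.

Section NoCornerDerivation.
Variables (R : nuRingType) (primeR : prime_nuring R) (K : mquotient R).
Variables (d : R -> R) (der_d : derivation d).
Local Notation F := (clF K).
Local Notation Q := (clQ K).
Local Notation i := (@cli R K).
Hypothesis nocorner : ~ finite_corner K.

Lemma i_exp n x : i (x ^+ n.+1)%nu = i x ^+ n.+1.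
Proof.
elim: n => [|n IH]; first by rewrite expr1.
by rewrite exprS -IH -cliM.
Qed.

Variable n : nat.
Hypothesis dXn : forall x y, (d (x * y) ^+ n.+1 = d x ^+ n.+1 * d y ^+ n.+1)%nu.

Let A x : Q := i (d x).
Let B a x : Q := i (d (a * x)%nu).

Lemma dlinD : {morph A : x y / x + y}.
Proof. by move=> x y; rewrite /A (dD der_d) cliD. Qed.

Lemma BlinD a : {morph B a : x y / x + y}.
Proof. by move=> x y; rewrite /B numulDr (dD der_d) cliD. Qed.

Lemma polarized a s : size s = n.+1 ->
  sym_prod (B a) n.+1 s = A a ^+ n.+1 * sym_prod A n.+1 s.
Proof.
apply: polarize; [exact: dlinD|exact: BlinD|] => y.
by rewrite /B /A -!i_exp dXn cliM.
Qed.

(** Let [S k] be the symmetrized product of [k] values of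
    [B y = d a * y + a * d y]. Its last factor ends in [q] or in [d q], and as
    [d] is outer the terms that end in [q] can be singled out. The polarized
    identity thus yields [S n * d a = 0], and [S k.+1 * p = 0] with [p] nonzero
    yields [S k * d a = 0]. At [k = 0] this says [d a = 0]. *)
Lemma outer_der0 : ~ (exists b : Q, inner_by d b) -> forall a, d a = 0.
Proof.
move=> outer a; apply: contrapT => da0.
have Aa0 : A a <> 0 by move/(@cli_inj _ K).
have AD := dlinD.
have fr0 f W : elementary A f -> (forall x, spn W (f x)) -> forall x, f x = 0.
  move=> [L0 [L1 fE]] fr x.
  have d1 : forall x, ev L1 (i (d x)) = 0.
    by apply: (outer_der_part primeR der_d nocorner outer (L0 := L0) (W := W))
      => y; rewrite -fE.
  rewrite fE d1 addr0; apply: (ev_finite_rank primeR nocorner (W := W)) => y.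
  by have := fr y; rewrite fE d1 addr0.
have he0 (C D : Q) (L0 L1 : seq (Q * Q)) : ~ spn [seq e.2 | e <- L0] D ->
    (forall x, C * i x * D + ev L0 (i x) + ev L1 (A x) = 0) -> C = 0.
  move=> nD h; have d1 : forall x, ev L1 (i (d x)) = 0.
    apply: (outer_der_part primeR der_d nocorner outer (L0 := (C, D) :: L0)
      (W := [::])) => y; by rewrite ev_cons h.
  apply: (ev_head_eq0 primeR nocorner nD (W := [::])) => y.
  by have := h y; rewrite /A d1 addr0.
pose L := sym_letters A (B a) A [:: 1] [:: 1; A a; i a].
have BE x : B a x = A a * i x + i a * A x by rewrite /B /A (idM _ der_d).
have Bl : lin_in A (fun w => w \in [:: 1]) (B a).
  exists [:: (A a, 1)], [:: (i a, 1)]; split=> [x|e].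
    by rewrite /ev !big_seq1 /= !mulr1.
  by rewrite !inE => /eqP->.
have Al : lin_in A (fun w => w \in [:: 1]) A.
  exists [::], [:: (1, 1)]; split=> [x|//].
  by rewrite /ev big_nil big_seq1 /= mulr1 mul1r add0r.
have EL := @sym_letters_elementary _ _ A (B a) A [:: 1] [:: 1; A a; i a] Bl Al.
have tB k X : X \in [:: 1; A a; i a] ->
    tame A L k (fun s => sym_prod (B a) k s * X).
  by move=> XX; apply: sym_prod_tame => //; rewrite !inE eqxx ?orbT.
have tA k X : X \in [:: 1; A a; i a] ->
    tame A L k (fun s => sym_prod A k s * X).
  by move=> XX; apply: sym_prod_tame => //; rewrite !inE eqxx ?orbT.
have ns0 (p : Q) : p <> 0 -> ~ spn [:: 0] p.
  by move=> p0 [k /=]; rewrite scaler0 subr0.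
have t0 k : tame A L k (fun _ => 0).
  split=> [s1 x y s2 _|s _]; first by rewrite addr0.
  by exists [::], [::]; split=> // x; rewrite /ev !big_nil addr0.
have coef := sym_coef_eq0 dlinD fr0 he0 EL.
have step k p : p <> 0 ->
    (forall s, size s = k.+1 -> sym_prod (B a) k.+1 s * p = 0) ->
    forall s, size s = k -> sym_prod (B a) k s * A a = 0.
  move=> p0 h; apply: (coef _ (fun s => sym_prod (B a) k s * A a) (fun _ => 0)
     (fun s => sym_prod (B a) k s * i a) p 0 p).
  - by apply: tB; rewrite !inE eqxx orbT.
  - exact: t0.
  - by apply: tB; rewrite !inE eqxx !orbT.
  - exact: ns0.
  - move=> s /h hs; rewrite -[RHS]hs /= mulr_suml; apply: eq_bigr => q _.
    by rewrite BE; ncring.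
have start s : size s = n -> sym_prod (B a) n s * A a = 0.
  move: s; apply: (coef _ (fun s => sym_prod (B a) n s * A a) (fun _ => 0)
     (fun s => sym_prod (B a) n s * i a + - A a ^+ n.+1 * (sym_prod A n s * 1)) 1 0 1).
  - by apply: tB; rewrite !inE eqxx orbT.
  - exact: t0.
  - apply: tameD; first by apply: tB; rewrite !inE eqxx !orbT.
    by apply: tame_mull; apply: tA; rewrite !inE eqxx.
  - by apply/ns0/eqP/oner_neq0.
  - move=> s /(polarized a) /eqP; rewrite -subr_eq0 => /eqP hs.
    rewrite -[RHS]hs /= mulr_sumr -sumrB; apply: eq_bigr => q _.
    by rewrite BE; ncring.
have desc k : (k <= n)%N -> forall s, size s = (n - k)%N ->
    sym_prod (B a) (n - k) s * A a = 0.
  elim: k => [|k IH] kn; first by rewrite subn0.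
  by apply: (step _ (A a)) => //; rewrite subnSK //; apply: IH; apply: ltnW.
by have := desc n (leqnn n) [::]; rewrite subnn /= mul1r => /(_ erefl).
Qed.

(** Here [B y = b * a * y - a * y * b] and [d y = b * y - y * b]; the last entry is
    followed by [1] or by [b]. Comparing both coefficients in the polarized identity
    gives [S n * b * a = c * T n * b] and [S n * a = c * T n], where [S k] and [T k]
    are the symmetrized products of [k] values of [B] and of [d], and hence
    [S n * d a = 0]. If [S k.+1 * p = 0] and [p], [b * p] are independent, then the
    coefficient of [b * p] gives [S k * a = 0]. By genericity [a] can be chosen so
    that the condition holds for [p = d a] and for [p = a]; in particular both are
    nonzero. But the descent ends with [a = 0], or with [d a = 0] if [n = 0]. *)
Lemma inner_der0 (b : Q) : inner_by d b -> forall a, d a = 0.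
Proof.
move=> bP; apply: contrapT => /existsNP[a0 da0].
pose U (x : R) : Q := 0.
have UD : {morph U : x y / x + y} by move=> x y; rewrite addr0.
have evU L x : ev L (U x) = 0 by rewrite ev0.
have fr0 f W : elementary U f -> (forall x, spn W (f x)) -> forall x, f x = 0.
  move=> [L0 [L1 fE]] fr x; rewrite fE evU addr0.
  apply: (ev_finite_rank primeR nocorner (W := W)) => y.
  by have := fr y; rewrite fE evU addr0.
have he0 (C D : Q) (L0 L1 : seq (Q * Q)) : ~ spn [seq e.2 | e <- L0] D ->
    (forall x, C * i x * D + ev L0 (i x) + ev L1 (U x) = 0) -> C = 0.
  move=> nD h; apply: (ev_head_eq0 primeR nocorner nD (W := [::])) => y.
  by have := h y; rewrite evU addr0.
(* [b] is not a scalar since [d] is nonzero *)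
have nb : ~ spn [:: 1] b.
  move=> [k /= /eqP]; rewrite subr_eq0 => /eqP bk; apply: da0; apply: (@cli_inj _ K).
  by rewrite bP bk -scalerAl -scalerAr mul1r mulr1 subrr.
have ns0 (p : Q) : p <> 0 -> ~ spn [:: p * 0] p.
  by move=> p0 [k /=]; rewrite mulr0 scaler0 subr0.
have n1 : ~ spn [:: b] 1.
  move=> /spn_exchange/(_ (elimN eqP (oner_neq0 _))); exact: nb.
have lin0 (h k : F) : h *: b + k *: 1 = 0 -> h = 0 /\ k = 0.
  move=> /eqP; rewrite addr_eq0 => /eqP hb.
  have h0 : h = 0.
    apply: contra_notP nb => /eqP h0; rewrite -[b](scalerK h0) hb.
    by apply/spnZ/spnN/spnZ/spn_mem; rewrite inE.
  split=> //; move/eqP: hb; rewrite h0 scale0r eq_sym oppr_eq0 scaler_eq0 oner_eq0.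
  by rewrite orbF => /eqP.
pose V := [:: (fun x => b * i x : Q); i; (fun x => b * A x); A].
have [a fa] : exists a, free_mod [::] (evl V a).
  apply: amitsur => [|e [j jV ej] W].
    have bA (f : R -> Q) : {morph f : x y / x + y} -> add_map (fun x => b * f x).
      by move=> fD x y; rewrite fD mulrDr.
    have iD : {morph i : x y / x + y} by move=> x y; rewrite cliD.
    by do 4?split => //; [exact: bA|exact: bA dlinD|exact: dlinD].
  apply: contrapT => /forallNP h.
  pose E2 := - (e 2%N *: b + e 3%N *: 1).
  pose E1 := e 0%N *: b + e 1%N *: 1 - E2 * b.
  have fr x : spn W (ev [:: (E2, b); (E1, 1)] (i x)).
    have /contrapT := h x; apply: spn_cong.
    rewrite /E1 /E2 /V /= /A bP /ev !big_cons big_nil /= !addr0.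
    pose c (k : F) : Q := k%:A.
    have zc (k : F) (q : Q) : k *: q = c k * q by rewrite /c -scalerAl mul1r.
    by rewrite !zc; ncring.
  have nb' : ~ spn [seq l.2 | l <- [:: (E1, 1)]] b by [].
  have E20 : E2 = 0.
    apply: (ev_head_eq0 primeR nocorner nb' (W := W)) => x.
    by have := fr x; rewrite ev_cons.
  have E10 : E1 = 0.
    apply: (ev_head_eq0 primeR nocorner (L := [::]) (B := 1) (W := W)) => [|x].
      exact/eqP/oner_neq0.
    by have := fr x; rewrite ev_cons E20 /= !mul0r add0r ev_cons.
  have [e2 e3] : e 2%N = 0 /\ e 3%N = 0.
    by apply: lin0; apply/eqP; rewrite -oppr_eq0; apply/eqP.
  have [e0 e1] : e 0%N = 0 /\ e 1%N = 0.
    by apply: lin0; rewrite -E10 /E1 E20 mul0r subr0.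
  by move: ej; case: j jV => [|[|[|[|]]]] // _; rewrite ?e0 ?e1 ?e2 ?e3 eqxx.
case: fa => nba [_ [nbda _]].
have {}nba : ~ spn [:: i a] (b * i a).
  move=> h; apply: nba; apply: spn_subset h => w.
  by rewrite !inE => /eqP->; rewrite eqxx.
have {}nbda : ~ spn [:: A a] (b * A a) by [].
pose L := sym_letters U (B a) A [:: 1; b] [:: 1; b * i a; i a; b].
have AE x : A x = b * i x - i x * b by rewrite /A bP.
have BE x : B a x = b * i a * i x - i a * i x * b.
  by rewrite /B bP cliM; ncring.
have Bl : lin_in U (fun w => w \in [:: 1; b]) (B a).
  exists [:: (b * i a, 1); (- i a, b)], [::]; split=> [x|e].
    by rewrite BE /ev !big_cons !big_nil /=; ncring.
  by rewrite !inE => /orP[] /eqP-> /=; rewrite eqxx ?orbT.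
have Al : lin_in U (fun w => w \in [:: 1; b]) A.
  exists [:: (b, 1); (- 1, b)], [::]; split=> [x|e].
    by rewrite AE /ev !big_cons !big_nil /=; ncring.
  by rewrite !inE => /orP[] /eqP-> /=; rewrite eqxx ?orbT.
have EL := @sym_letters_elementary _ _ U (B a) A
  [:: 1; b] [:: 1; b * i a; i a; b] Bl Al.
have tB k X : X \in [:: 1; b * i a; i a; b] ->
    tame U L k (fun s => sym_prod (B a) k s * X).
  by move=> XX; apply: sym_prod_tame => //; rewrite !inE eqxx ?orbT.
have tA k X : X \in [:: 1; b * i a; i a; b] ->
    tame U L k (fun s => sym_prod A k s * X).
  by move=> XX; apply: sym_prod_tame => //; rewrite !inE eqxx ?orbT.
have t0 k : tame U L k (fun _ => 0).
  split=> [s1 x y s2 _|s _]; first by rewrite addr0.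
  by exists [::], [::]; split=> // x; rewrite /ev !big_nil addr0.
have coef := sym_coef_eq0 UD fr0 he0 EL.
have step k p : ~ spn [:: p] (b * p) ->
    (forall s, size s = k.+1 -> sym_prod (B a) k.+1 s * p = 0) ->
    forall s, size s = k -> sym_prod (B a) k s * i a = 0.
  move=> np h s szs; have : - 1 * (sym_prod (B a) k s * i a) = 0.
    move: s szs; apply: (coef _ (fun s => - 1 * (sym_prod (B a) k s * i a))
       (fun s => sym_prod (B a) k s * (b * i a))
       (fun _ => 0) (b * p) p 0).
    - by apply: tame_mull; apply: tB; rewrite !inE eqxx !orbT.
    - by apply: tB; rewrite !inE eqxx orbT.
    - exact: t0.
    - exact: np.
    - move=> s /h hs; rewrite -[RHS]hs /= mulr_suml; apply: eq_bigr => q _.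
      by rewrite BE; ncring.
  by move/eqP; rewrite mulN1r oppr_eq0 => /eqP.
pose h1 s : Q := sym_prod (B a) n s * (b * i a) + - A a ^+ n.+1 * (sym_prod A n s * b).
pose h2 s : Q := - 1 * (sym_prod (B a) n s * i a) + A a ^+ n.+1 * (sym_prod A n s * 1).
have th1 : tame U L n h1.
  apply: tameD; first by apply: tB; rewrite !inE eqxx !orbT.
  by apply: tame_mull; apply: tA; rewrite !inE eqxx !orbT.
have th2 : tame U L n h2.
  apply: tameD; apply: tame_mull; first by apply: tB; rewrite !inE eqxx !orbT.
  by apply: tA; rewrite !inE eqxx.
have top s : size s = n.+1 -> \sum_(q <- splits s)
    (h1 q.2 * i q.1 * 1 + h2 q.2 * i q.1 * b + 0 * U q.1 * 0) = 0.
  move=> /(polarized a) /eqP; rewrite -subr_eq0 => /eqP hs.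
  rewrite -[RHS]hs /= mulr_sumr -sumrB; apply: eq_bigr => q _.
  by rewrite BE (AE q.1) /h1 /h2; ncring.
have start s : size s = n -> sym_prod (B a) n s * A a = 0.
  move=> szs; have h10 : h1 s = 0.
    exact: (coef n h1 h2 (fun _ => 0) 1 b 0 th1 th2 (t0 n) n1 top s szs).
  have h20 : h2 s = 0.
    apply: (coef n h2 h1 (fun _ => 0) b 1 0 th2 th1 (t0 n) nb) => // s' /top hs.
    rewrite -[RHS]hs; by apply: eq_bigr => q _; ncring.
  transitivity (h1 s + h2 s * b); last by rewrite h10 h20 mul0r addr0.
  by rewrite /h1 /h2 AE; ncring.
have desc k : (k < n)%N -> forall s, size s = (n - k.+1)%N ->
    sym_prod (B a) (n - k.+1) s * i a = 0.
  elim: k => [|k IH] kn.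
    by apply: (step _ (A a)) => //; rewrite subnSK // subn0.
  by apply: (step _ (i a)) => //; rewrite subnSK //; apply: IH; apply: ltnW.
case: (posnP n) => n0.
  have := start [::]; rewrite n0 /= mul1r => /(_ erefl) Aa; apply: nbda.
  by rewrite Aa mulr0; apply: spn0.
have := desc n.-1; rewrite prednK // leqnn subnn => /(_ isT [::] erefl).
by rewrite /= mul1r => ia; apply: nba; rewrite ia mulr0; apply: spn0.
Qed.

Lemma no_corner_der0 a : d a = 0.
Proof.
have [[b bP]|outer] := pselect (exists b : Q, inner_by d b).
  exact: inner_der0 bP a.
exact: outer_der0.
Qed.

End NoCornerDerivation.

(** * Nil elements and idempotents *)

Section Levitzki.
Variables (R : nuRingType) (primeR : prime_nuring R) (K : mquotient R).
Local Notation F := (clF K).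
Local Notation Q := (clQ K).
Local Notation i := (@cli R K).
Implicit Types (x y z r s t u v c : R) (p q : Q).

Lemma mulr_exp_i c x m : exists y, i x * (i c * i x) ^+ m = i y.
Proof.
elim: m => [|m [y yE]]; first by exists x; rewrite expr0 mulr1.
by exists (y * (c * x))%nu; rewrite exprSr mulrA yE !cliM.
Qed.

Lemma exp_square_zero p q m : p * p = 0 ->
  (p * q + p) ^+ m.+1 = (p * q) ^+ m.+1 + (p * q) ^+ m * p.
Proof.
move=> pp; elim: m => [|m IH]; first by rewrite !expr1 expr0 mul1r.
rewrite exprSr IH [in RHS]exprSr [in RHS]exprSr.
have -> : ((p * q) ^+ m.+1 + (p * q) ^+ m * p) * (p * q + p) =
  (p * q) ^+ m.+1 * (p * q) + (p * q) ^+ m.+1 * p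
  + (p * q) ^+ m * (p * p) * (q + 1) by ncring.
by rewrite pp mulr0 mul0r addr0 exprSr.
Qed.

(** Levitzki's theorem for prime rings. If [u = c * y] has square [0], the
    hypothesis at [y * (c * r) + y] gives [(u * c * r) ^+ m * (u * c) = 0], so
    [u * c = 0] by induction. Powers of [c * x] may be taken for [u], which brings
    the exponent down to [2]; there linearization applies. *)
Lemma levitzki m c : (forall x, (i c * i x) ^+ m * i c = 0) -> c = 0.
Proof.
elim: m c => [|m IH] c H; first by apply: (@cli_inj _ K); have := H c; rewrite mul1r.
have sq0 y : (i c * i y) * (i c * i y) = 0 -> i c * i y * i c = 0.
  move=> uu; rewrite -!cliM (IH (c * y * c)%nu) ?i0 // => r.
  have := H (y * c * r)%nu; have := H (y * (c * r) + y)%nu; rewrite cliD !cliM.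
  set u := i c * i y in uu *.
  have -> : i c * (i y * (i c * i r) + i y) = u * (i c * i r) + u.
    by rewrite /u; ncring.
  have -> : i c * (i y * i c * i r) = u * (i c * i r) by rewrite /u; ncring.
  have -> : u * i c * i r = u * (i c * i r) by ncring.
  by rewrite (exp_square_zero _ _ uu) mulrDl => + h; rewrite h add0r -mulrA.
have drop x l : (i c * i x) ^+ l.+3 * i c = 0 -> (i c * i x) ^+ l.+2 * i c = 0.
  have [y yE] := mulr_exp_i c x l.+1; set t := i c * i x in yE * => h.
  have tE : t ^+ l.+2 = i c * i y by rewrite exprS -yE mulrA.
  rewrite tE; apply: sq0; rewrite -tE -exprD.
  have -> : (l.+2 + l.+2 = l.+3 + (1 + l))%N by rewrite add1n [RHS]addSnnS.
  by rewrite !exprD expr1 {2}/t !mulrA h !mul0r.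
have sq x : (i c * i x) ^+ 2 * i c = 0.
  suff : (i c * i x) ^+ m.+2 * i c = 0 by elim: (m) => // l IHl /drop/IHl.
  by rewrite exprS -mulrA H mulr0.
have lin x y : i c * i x * i c * i y * i c = - (i c * i y * i c * i x * i c).
  have := sq (x + y)%nu; have := sq x; have := sq y; rewrite !expr2 cliD => hy hx.
  set X := i c * i x in hx *; set Y := i c * i y in hy *.
  have -> : i c * (i x + i y) = X + Y by rewrite mulrDr.
  move=> h; apply/eqP; rewrite -addr_eq0; apply/eqP.
  transitivity ((X + Y) * (X + Y) * i c - X * X * i c - Y * Y * i c).
    by rewrite /X /Y; ncring.
  by rewrite h hx hy !subr0.
have cxc x : i c * i x * i c = 0.
  rewrite -!cliM; have [//|nz] := pselect (i (c * x * c)%nu = 0).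
  apply: (prime_i primeR (x := (c * x * c)%nu)) => [h|y].
    by apply: nz; rewrite h i0.
  have := lin x (y * c * x)%nu; rewrite !cliM => h.
  transitivity (i c * i x * i c * (i y * i c * i x) * i c); first by ncring.
  have := sq x; rewrite expr2 => h'; rewrite h.
  transitivity (- (i c * i y * (i c * i x * (i c * i x) * i c))); first by ncring.
  by rewrite h' mulr0 oppr0.
by have [r|//|//] := primeR (a := c) (b := c); apply: (@cli_inj _ K); rewrite !cliM.
Qed.

End Levitzki.

Section Corner.
Variables (R : nuRingType) (primeR : prime_nuring R) (K : mquotient R).
Variables (d : R -> R) (der_d : derivation d) (n : nat).
Hypothesis dXn : forall x y, (d (x * y) ^+ n.+1 = d x ^+ n.+1 * d y ^+ n.+1)%nu.
Local Notation F := (clF K).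
Local Notation Q := (clQ K).
Local Notation i := (@cli R K).
Implicit Types (x y z r s t u v c : R) (p q e : Q) (W : seq Q).

Let idXn x y : i (d (x * y)%nu) ^+ n.+1 = i (d x) ^+ n.+1 * i (d y) ^+ n.+1.
Proof. by rewrite -!i_exp dXn cliM. Qed.

(** For [y = t * x * s] with [s * t = 0] the square of [d y ^+ n.+1] is
    [d (y * y) ^+ n.+1 = 0], while [s * d y ^+ m = (s * d t * x) ^+ m * s]. So
    Levitzki's theorem applies to [s * d t]. *)
Lemma zero_product s t : i s * i t = 0 -> i s * i (d t) = 0.
Proof.
move=> st; rewrite -cliM (_ : (s * d t)%nu = 0) ?i0 //.
apply: (levitzki primeR (K := K) (m := n.+1 + n.+1)) => x.
rewrite [in LHS]cliM.
set y := (t * x * s)%nu.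
have dy0 : i (d y) ^+ (n.+1 + n.+1) = 0.
  rewrite exprD -idXn (_ : (y * y)%nu = 0) ?(d0 der_d) ?i0 ?expr0n //.
  apply: (@cli_inj _ K); rewrite /y !cliM.
  transitivity (i t * i x * (i s * i t) * i x * i s); first by ncring.
  by rewrite st mulr0 !mul0r.
have sdy m : i s * i (d y) ^+ m = (i s * i (d t) * i x) ^+ m * i s.
  elim: m => [|m IH]; first by rewrite !expr0 mulr1 mul1r.
  rewrite exprSr mulrA IH exprSr -!mulrA; congr (_ * _).
  rewrite /y !(idM _ der_d) !cliM.
  transitivity (i s * i (d t) * i x * i s
    + (i s * i t) * (i (d x) * i s + i x * i (d s))); first by ncring.
  by rewrite st mul0r addr0 -!mulrA.
rewrite mulrA.
have := sdy (n.+1 + n.+1)%N; rewrite dy0 mulr0 => <-.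
exact: mul0r.
Qed.

(** The graph of the extension of [d] to the quotient ring, which is characterized
    by [q' * X = d (q * X) - q * d X]. *)
Definition is_der q q' := large (fun X => exists Z V,
  [/\ q * i X = i Z, q * i (d X) = i V & q' * i X = i (d Z) - i V]).

Lemma is_der_uniq q p p' : is_der q p -> is_der q p' -> p = p'.
Proof.
move=> h h'; apply/eqP; rewrite -subr_eq0; apply/eqP; apply: cl_faith.
apply: large_imp (largeI primeR h h') => X [[Z [V [h1 h2 h3]]] [Z' [V' [k1 k2 k3]]]].
have ZZ : Z = Z' by apply: (@i_inj _ K); rewrite -h1.
have VV : V = V' by apply: (@i_inj _ K); rewrite -h2.
by rewrite mulrBl h3 k3 ZZ VV subrr.
Qed.

Lemma large_pre_q q (S : R -> Prop) : large S ->
  large (fun X => exists2 Z, q * i X = i Z & S Z).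
Proof.
move=> [a a0 Sa]; have [b b0 qb] := cl_dom q.
have [t c0] := prime_sep primeR b0 a0; exists (b * t * a)%nu => // r s.
have [y yE] := qb r t; exists (y * a * s)%nu => //.
by rewrite !cliM -yE !cliM !mulrA.
Qed.

Lemma large_pre_der q (S : R -> Prop) : large S ->
  (forall x y, S x -> S y -> S (x + y)) -> (forall x r, S x -> S (x * r)%nu) ->
  large (fun X => exists2 V, q * i (d X) = i V & S V).
Proof.
move=> SL SD SM; have [c c0 qc] := large_pre_q q SL.
have [t cc0] := prime_sep primeR c0 c0; exists (c * t * c)%nu => // r s.
have [V1 V1E SV1] := qc (d (r * c * t)%nu) s.
have [V2 V2E SV2] := qc r t.
exists (V1 + V2 * d (c * s)%nu)%nu; last by apply: SD => //; apply: SM.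
have -> : (r * (c * t * c) * s = (r * c * t) * (c * s))%nu by rewrite !numulA.
by rewrite (idM _ der_d) mulrDr cliD [i (V2 * _)%nu]cliM -V1E -V2E !cliM !mulrA.
Qed.

Lemma is_derD p q p' q' : is_der p p' -> is_der q q' -> is_der (p + q) (p' + q').
Proof.
move=> h h'; apply: large_imp (largeI primeR h h').
move=> X [[Z [V [h1 h2 h3]]] [Z' [V' [k1 k2 k3]]]]; exists (Z + Z'), (V + V').
by rewrite !mulrDl h1 h2 h3 k1 k2 k3 (dD der_d) !cliD; split=> //; ncring.
Qed.

Lemma is_derM p q p' q' : is_der p p' -> is_der q q' ->
  is_der (p * q) (p' * q + p * q').
Proof.
move=> h h'; have := large_pre_der q (S := fun V => exists w, p * i V = i w).
move=> /(_ (cl_dom p)) H.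
apply: large_imp (largeI primeR (largeI primeR h' (large_pre_q q h)) (H _ _)).
- move=> X [[[Z [V [h1 h2 h3]]]]] [Z0 h10 [Z2 [V2 [k1 k2 k3]]]] [V0 h20 [V3 kV]].
  have ZZ : Z0 = Z by apply: (@i_inj _ K); rewrite -h1.
  have VV : V0 = V by apply: (@i_inj _ K); rewrite -h2.
  subst Z0 V0; exists Z2, V3; split.
  + by rewrite -mulrA h1 k1.
  + by rewrite -mulrA h2 kV.
  + by rewrite mulrDl -!mulrA h1 h3 k3 mulrBr k2 kV; ncring.
- by move=> x y [w xw] [w' yw]; exists (w + w'); rewrite !cliD mulrDr xw yw.
- by move=> x r [w xw]; exists (w * r)%nu; rewrite !cliM mulrA xw.
Qed.

Lemma is_der_i x : is_der (i x) (i (d x)).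
Proof.
have [a a0 _] := cl_dom (i x); exists a => // r s.
move: (r * a * s)%nu => X; exists (x * X)%nu, (x * d X)%nu.
by rewrite (idM _ der_d) !cliM addrK.
Qed.

Lemma is_der_ex q : exists q', is_der q q'.
Proof.
pose G X Y := exists Z V, [/\ q * i X = i Z, q * i (d X) = i V & Y = d Z - V].
have Gdom : large (fun X => exists Y, G X Y).
  have TL : large (fun _ : R => True) by have [a a0 _] := cl_dom q; exists a.
  apply: large_imp (largeI primeR (cl_dom q) (large_pre_der q TL _ _)) => //.
  by move=> X [[Z h1] [V h2 _]]; exists (d Z - V), Z, V.
have [|q' q'G] := @cl_lift _ K G.
  split=> //.
  - move=> x y x' y' [Z [V [h1 h2 ->]]] [Z' [V' [k1 k2 ->]]].
    exists (Z - Z'), (V - V'); rewrite (dB der_d) !iB !mulrBr h1 h2 k1 k2 (dB der_d).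
    by split=> //; rewrite !opprD addrACA.
  - move=> x y r [Z [V [h1 h2 ->]]]; exists (Z * r)%nu, (V * r + Z * d r)%nu.
    rewrite (idM _ der_d) cliD !cliM mulrDr !mulrA h1 h2 (dM der_d) nuBl; split=> //.
    by rewrite opprD addrACA subrr addr0.
  - move=> y [Z [V [h1 h2 ->]]].
    have -> : Z = 0 by apply: (@cli_inj _ K); rewrite -h1 i0 mulr0.
    have -> : V = 0 by apply: (@cli_inj _ K); rewrite -h2 (d0 der_d) i0 mulr0.
    by rewrite (d0 der_d) subrr.
exists q'; apply: large_imp Gdom => X [Y GXY]; have := q'G _ _ GXY.
by case: GXY => Z [V [h1 h2 ->]] h3; exists Z, V; split=> //; rewrite h3 iB.
Qed.

Lemma is_der1 : is_der 1 0.
Proof.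
have [a a0 _] := cl_dom (1 : Q); exists a => // r s.
set X := (_ * _)%nu; exists X, (d X); rewrite !mul1r mul0r.
by split=> //; rewrite subrr.
Qed.

Lemma is_derN q q' : is_der q q' -> is_der (- q) (- q').
Proof.
move=> h; apply: large_imp h => X [Z [V [h1 h2 h3]]]; exists (- Z), (- V).
by rewrite !mulNr h1 h2 h3 (dN der_d) !iN; split=> //; ncring.
Qed.

(** Left denominators. They exist for the elements algebraic over [R], but not
    for all elements of a right quotient ring. *)
Definition ldom q := large (fun u => exists v, i u * q = i v).

Lemma ldom_i x : ldom (i x).
Proof.
have [a a0 _] := cl_dom (i x); exists a => // r s.
by exists (r * a * s * x)%nu; rewrite !cliM.
Qed.

Lemma ldomD p q : ldom p -> ldom q -> ldom (p + q).
Proof.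
move=> h h'; apply: large_imp (largeI primeR h h') => u [[v h1] [w h2]].
by exists (v + w); rewrite mulrDr cliD h1 h2.
Qed.

Lemma ldomN q : ldom q -> ldom (- q).
Proof. by apply: large_imp => u [v h]; exists (- v); rewrite mulrN iN h. Qed.

Lemma ldomM p q : ldom p -> ldom q -> ldom (p * q).
Proof.
move=> [b b0 pb] [a a0 qa]; have [t c0] := prime_sep primeR a0 b0.
exists (a * t * b)%nu => // r s.
have [v vE] := pb t s; have [w wE] := qa r v; exists w.
rewrite -wE !cliM -vE !cliM; ncring.
Qed.

Lemma ldom_scale (k : F) q : ldom q -> ldom (k *: q).
Proof.
move=> qd; rewrite -[q]mul1r scalerAl; apply: ldomM => //.
apply: large_imp (cl_dom (k%:A : Q)) => u [v kuv]; exists v; rewrite -kuv.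
by rewrite -scalerAl -scalerAr mul1r mulr1.
Qed.

Lemma ldom1 : ldom 1.
Proof.
have [a a0 _] := cl_dom (1 : Q); exists a => // r s.
by exists (r * a * s)%nu; rewrite mulr1.
Qed.

Lemma lfaith q : large (fun u => i u * q = 0) -> q = 0.
Proof.
move=> [a a0 aq]; have [t c0] := prime_sep primeR a0 a0.
apply: (prime_i primeR c0) => r; have := aq (a * t)%nu r.
by rewrite !cliM.
Qed.

Lemma prime_q p q : (forall y, p * i y * q = 0) -> p = 0 \/ q = 0.
Proof.
move=> h; have [->|p0] := pselect (p = 0); [by left|right].
have [u [v [v0 puv]]] := q_nz p0; apply: (prime_i primeR v0) => y.
by rewrite -puv -[p * _ * _]mulrA -cliM h.
Qed.

(** For [v = u * e] in [R] the product of [v] with [(1 - e) * w] vanishes, so [v] also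
    kills its derivative, which gives [e * e' = 0] for the derivative [e'] of [e].
    With [1 - e] in place of [e] one gets [(1 - e) * e' = 0]. *)
Lemma idempotent_constant e : e * e = e -> ldom e -> is_der e 0.
Proof.
move=> ee le; have [e' de] := is_der_ex e.
suff e'0 : e' = 0 by rewrite e'0 in de.
have ee' : e * e' = 0.
  apply: lfaith; apply: large_imp le => u [v uv].
  apply: cl_faith; apply: large_imp de => w [Z [V [h1 h2 h3]]].
  have z : i v * i (d (w - Z)) = 0.
    apply: zero_product; rewrite iB -uv -h1 mulrBr !mulrA.
    by rewrite -[i u * e * e]mulrA ee subrr.
  have h4 : i v * e = i v by rewrite -uv -mulrA ee.
  transitivity (- (i v * i (d (w - Z)))); last by rewrite z oppr0.
  rewrite (dB der_d) iB mulrBr mulrA uv -mulrA h3 mulrBr -h2 mulrA h4; ncring.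
have ee'' : (1 - e) * e' = 0.
  apply: lfaith; apply: large_imp le => u [v uv].
  apply: cl_faith; apply: large_imp de => w [Z [V [h1 h2 h3]]].
  have uvE : i (u - v) = i u * (1 - e) by rewrite iB -uv mulrBr mulr1.
  have h4 : i (u - v) * e = 0 by rewrite uvE -mulrA mulrBl mul1r ee subrr mulr0.
  have z : i (u - v) * i (d Z) = 0.
    by apply: zero_product; rewrite -h1 mulrA h4 mul0r.
  by rewrite mulrA -uvE -mulrA h3 mulrBr z -h2 mulrA h4 mul0r subrr.
by rewrite -[e']mul1r -[1](subrK e) mulrDl ee'' ee' addr0.
Qed.

(** As constants, the idempotents [e + e * q * (1 - e)] give
    [e * d q * (1 - e) = 0]. Taking [z * e * y * (1 - e)] for [q] yields
    [e * d z * e * y * (1 - e) = 0], so [e * d z * e = 0] by primeness, and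
    altogether [e * d z = 0]. Then [e * r * d x = e * d (r * x) = 0]. *)
Lemma nontrivial_idempotent e : e * e = e -> ldom e -> e <> 0 -> e <> 1 ->
  forall x, d x = 0.
Proof.
move=> ee le e0 e1 x; have de := idempotent_constant ee le.
have l1e : ldom (1 - e) by apply: ldomD; [exact: ldom1|exact: ldomN].
have d1e : is_der (1 - e) 0.
  by have := is_derD is_der1 (is_derN de); rewrite oppr0 addr0.
have e1e : (1 - e) * e = 0 by rewrite mulrBl mul1r ee subrr.
have corner q q' : ldom q -> is_der q q' -> e * q' * (1 - e) = 0.
  move=> lq dq.
  have := is_derM (is_derM de dq) d1e; rewrite mul0r add0r mulr0 addr0.
  set g := e * q * (1 - e) => dg.
  have ge : g * e = 0 by rewrite -mulrA e1e mulr0.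
  have eg : e * g = g by rewrite /g !mulrA ee.
  have gg : g * g = 0 by rewrite -{2}eg mulrA ge mul0r.
  have := @idempotent_constant (e + g) _ _.
  have h1 : (e + g) * (e + g) = e + g.
    by rewrite mulrDr !mulrDl ee ge gg eg !addr0.
  have h2 : ldom (e + g).
    by apply: ldomD => //; apply: ldomM => //; apply: ldomM.
  move=> /(_ h1 h2) dz; have := is_derD de dg; rewrite add0r => dz'.
  exact: is_der_uniq dz' dz.
have mid z : e * i (d z) * e = 0 \/ 1 - e = 0.
  apply: prime_q => y.
  have := corner _ _ (ldomM (ldomM (ldom_i z) le) (ldomM (ldom_i y) l1e))
    (is_derM (is_derM (is_der_i z) de) (is_derM (is_der_i y) d1e)).
  have h0 := corner _ _ (ldom_i y) (is_der_i y).
  set X := i (d z); rewrite !mulr0 !addr0 => h.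
  have s1 : (1 - e) * (1 - e) = 1 - e by rewrite mulrBr mulr1 e1e subr0.
  transitivity (e * X * e * i y * ((1 - e) * (1 - e))); first by rewrite s1.
  transitivity (e * (X * e * (i y * (1 - e)) + i z * e * (i (d y) * (1 - e))) * (1 - e)
    - e * i z * (e * i (d y) * (1 - e)) * (1 - e)); first by ncring.
  by rewrite h h0 mulr0 mul0r subr0.
have ex y : e * i (d y) = 0.
  have := corner _ _ (ldom_i y) (is_der_i y).
  have [p0|e10] := mid y; last by case: e1; apply/esym/eqP; rewrite -subr_eq0 e10.
  by rewrite mulrBr mulr1 p0 subr0.
have [//|dx] : e = 0 \/ i (d x) = 0; last exact: (@cli_inj _ K).
apply: prime_q => r; have := ex (r * x)%nu.
by rewrite (idM _ der_d) mulrDr mulrA ex mul0r add0r mulrA.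
Qed.

End Corner.

(** * Idempotents from finite-dimensional corners *)

Section Powers.
Variables (R : nuRingType) (primeR : prime_nuring R) (K : mquotient R).
Local Notation F := (clF K).
Local Notation Q := (clQ K).
Local Notation i := (@cli R K).
Implicit Types (x y z r s u v c w : R) (p q t : Q) (W : seq Q).

Inductive poly_in t : Q -> Prop :=
| poly_in0 : poly_in t 0
| poly_inS (k : F) p : poly_in t p -> poly_in t (k%:A + t * p).

Lemma scalar_comm (k : F) q : k%:A * q = q * k%:A.
Proof. by rewrite -scalerAl -scalerAr mul1r mulr1. Qed.

Lemma poly_in_comm t p : poly_in t p -> p * t = t * p.
Proof.
elim=> [|k q _ IH]; first by rewrite mulr0 mul0r.
by rewrite mulrDl mulrDr scalar_comm -mulrA IH.
Qed.

Lemma poly_in_ldom t p : ldom t -> poly_in t p -> ldom p.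
Proof.
move=> lt; elim=> [|k q _ IH].
  by rewrite -(i0 K); apply: ldom_i.
by apply: ldomD => //; [apply: (ldom_scale primeR); apply: ldom1|apply: ldomM].
Qed.

Fixpoint pows t p k j : seq Q :=
  if k is k'.+1 then t ^+ j * p :: pows t p k' j.+1 else [::].

Lemma size_pows t p k j : size (pows t p k j) = k.
Proof. by elim: k j => //= k IH j; rewrite IH. Qed.

Lemma mem_pows t p k j q : q \in pows t p k j -> exists2 l, (j <= l)%N & q = t ^+ l * p.
Proof.
elim: k j => //= k IH j; rewrite inE => /orP[/eqP->|/IH[l jl ->]]; first by exists j.
by exists l => //; apply: ltnW.
Qed.

Lemma spn_pows t g k j q : spn (pows t g k j) q ->
  exists2 p, poly_in t p & q = t ^+ j * (p * g).
Proof.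
elim: k j q => [|k IH] j q.
  by move=> /= ->; exists 0; [exact: poly_in0|rewrite mul0r mulr0].
move=> [a /IH[p pt /eqP]]; rewrite subr_eq => /eqP ->.
exists (a%:A + t * p); first exact: poly_inS.
have sc := scalar_comm a (t ^+ j); rewrite exprSr -[t ^+ j * g]mul1r scalerAl.
transitivity (t ^+ j * t * (p * g) + t ^+ j * a%:A * g); last by ncring.
by rewrite -sc; ncring.
Qed.

Lemma pows_dep t g k j : ~ free_mod [::] (pows t g k j) -> exists m p,
  [/\ (j <= m < j + k)%N, poly_in t p & t ^+ m * g = t ^+ m.+1 * (p * g)].
Proof.
elim: k j => [|k IH] j /=; first by case.
have [fr|nf _] := pselect (free_mod [::] (pows t g k j.+1)); last first.
  have [m [p [/andP[jm mk] pt h]]] := IH _ nf; exists m, p; split=> //.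
  by rewrite (ltnW jm) addnS.
move=> /not_andP[/contrapT|//]; rewrite cats0 => /spn_pows[p pt h].
by exists j, p; split=> //; rewrite leqnn addnS ltnS leq_addr.
Qed.

Lemma pows_finite t g W : (forall j, (0 < j)%N -> spn W (t ^+ j * g)) -> exists m p,
  [/\ (0 < m <= (size W).+1)%N, poly_in t p & t ^+ m * g = t ^+ m.+1 * (p * g)].
Proof.
move=> tW; have [|m [p [mW pt h]]] := @pows_dep t g (size W).+1 1; last by exists m, p.
move=> /(@free_mod_size _ _ W); rewrite size_pows ltnn.
suff H : forall q, q \in pows t g (size W).+1 1 -> spn (W ++ [::]) q by move=> /(_ H).
by move=> v /mem_pows[l l1 ->]; rewrite cats0; apply: tW.
Qed.

(** By Levitzki's theorem some [t = c * x] has a power beyond the dimension of the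
    corner that is not [0]. Linear dependence of the powers gives
    [t ^+ l = t ^+ l.+1 * p] with [p] a polynomial in [t], and [t ^+ l * p ^+ l] is
    then a nonzero idempotent. *)
Lemma corner_idempotent c W : c <> 0 -> (forall x, spn W (i c * i x * i c)) ->
  exists e p : Q, [/\ e * e = e, ldom e, e <> 0 & e = i c * p].
Proof.
move=> c0 cW; have [x ncx] : exists x, (i c * i x) ^+ (size W).+2 * i c <> 0.
  apply: contrapT => /forallNP h; apply: c0.
  by apply: (levitzki primeR (K := K) (m := (size W).+2)) => x; apply: contrapT.
set t := i c * i x in ncx.
have [|m [p [/andP[m0 mW] pt h]]] := @pows_finite t (i c) W.
  move=> [//|j] _; have [y yE] := mulr_exp_i K c x j.
  have -> : t ^+ j.+1 * i c = i c * (i x * t ^+ j) * i c.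
    by rewrite exprS {1}/t !mulrA.
  by rewrite yE.
have pC : GRing.comm t p by apply/esym/poly_in_comm.
have tp : t ^+ m.+1 = t ^+ m.+2 * p.
  transitivity (t ^+ m * i c * i x); first by rewrite exprSr -[RHS]mulrA.
  by rewrite h -[LHS]mulrA -[p * _ * _]mulrA -/t -pC mulrA -exprSr.
have {}tp l : t ^+ (m.+1 + l) = t ^+ (m.+1 + l).+1 * p.
  by rewrite addnC exprD tp mulrA -exprD addnS.
have tpl l : t ^+ m.+1 = t ^+ (m.+1 + l) * p ^+ l.
  elim: l => [|l IH]; first by rewrite addn0 mulr1.
  by rewrite {1}IH tp addnS -mulrA -exprS.
have cc : p ^+ m.+1 * t ^+ m.+1 = t ^+ m.+1 * p ^+ m.+1.
  by apply/commrX/commr_sym/commrX.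
have tt := tpl m.+1; rewrite exprD in tt.
exists (t ^+ m.+1 * p ^+ m.+1), (i x * t ^+ m * p ^+ m.+1); split.
- transitivity (t ^+ m.+1 * (p ^+ m.+1 * t ^+ m.+1) * p ^+ m.+1); first by ncring.
  by rewrite cc !mulrA -tt.
- have lt : ldom t by apply: ldomM => //; apply: ldom_i.
  have lX q l : ldom q -> ldom (q ^+ l).
    move=> lq; elim: l => [|l IH]; first by rewrite expr0; apply: ldom1.
    by rewrite exprS; apply: ldomM.
  by apply: ldomM => //; apply: lX => //; apply: poly_in_ldom pt.
- move=> e0; apply: ncx; have {}tt : t ^+ m.+1 = 0 by rewrite tt -mulrA e0 mulr0.
  have -> : (size W).+2 = ((size W).+1 - m + m.+1)%N by rewrite addnS subnK.
  by rewrite exprD tt mulr0 mul0r.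
- by rewrite exprS !mulrA.
Qed.

End Powers.

(** * Domains *)

Section Domain.
Variables (R : nuRingType) (primeR : prime_nuring R) (K : mquotient R).
Variables (d : R -> R) (der_d : derivation d) (n : nat).
Hypothesis dXn : forall x y, (d (x * y) ^+ n.+1 = d x ^+ n.+1 * d y ^+ n.+1)%nu.
Local Notation F := (clF K).
Local Notation Q := (clQ K).
Local Notation i := (@cli R K).
Implicit Types (x y z r s u v c w : R) (p q t : Q) (W : seq Q).

Hypothesis domain : forall x y, (x * y)%nu = 0 -> x = 0 \/ y = 0.

Let idXn x y : i (d (x * y)%nu) ^+ n.+1 = i (d x) ^+ n.+1 * i (d y) ^+ n.+1.
Proof. by rewrite -!i_exp dXn cliM. Qed.

Lemma domain_cancel c q : c <> 0 -> i c * q = 0 -> q = 0.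
Proof.
move=> c0 cq; apply: ncancel => u v quv.
have [|//|//] := domain (x := c) (y := v).
by apply: (@cli_inj _ K); rewrite cliM -quv mulrA cq mul0r.
Qed.

Lemma domain_exp x m : i x ^+ m = 0 -> x = 0.
Proof.
have [//|x0] := pselect (x = 0); elim: m => [/eqP|m IH].
  by rewrite expr0 oner_eq0.
by rewrite exprS => /(domain_cancel x0).
Qed.

(** If [d c = 0] then [(c * d x) ^+ n.+1 = d (c * x) ^+ n.+1 = 0]. *)
Lemma domain_constant c : c <> 0 -> d c = 0 -> forall x, d x = 0.
Proof.
move=> c0 dc x; have := idXn c x; rewrite dc i0 expr0n mul0r => /domain_exp.
rewrite (dM der_d) dc nu0r add0r => h.
by have [|//|//] := domain (x := c) (y := d x).
Qed.

(** If [d z] is nonzero, then [d (z ^ 2) = 2 z d z] and [d (z ^ 3) = 3 z ^ 2 d z] give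
    [(2 z) ^ N = d z ^ N] and [(3 z ^ 2) ^ N = d z ^ (N + N)] for [N = n.+1]. So
    [M = 4 ^ N - 3 ^ N] vanishes in [F], and [d (z ^ M) = M z ^ (M - 1) d z = 0]. *)
Lemma domain_central (z : R) (k : F) : z <> 0 -> i z = k%:A -> forall x, d x = 0.
Proof.
move=> z0 zk; have [dz0|dz] := pselect (d z = 0); first exact: domain_constant dz0.
have k0 : k != 0.
  by apply/eqP => k0; apply: z0; apply: (@cli_inj _ K); rewrite zk k0 scale0r.
have kexp m q : i z ^+ m * q = k ^+ m *: q.
  elim: m => [|m IH]; first by rewrite mul1r scale1r.
  by rewrite exprS -mulrA IH zk -scalerAl mul1r scalerA exprS.
have dexp m : exists2 y, i y = i z ^+ m.+1 & i (d y) = k ^+ m *: i (d z) *+ m.+1.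
  elim: m => [|m [y yE dyE]]; first by exists z; rewrite ?expr1 ?scale1r ?mulr1n.
  exists (z * y)%nu; first by rewrite cliM yE -exprS.
  rewrite (idM _ der_d) yE dyE mulrnAr [RHS]mulrS; congr (_ + _ *+ _).
    by rewrite -[i z ^+ _]mulr1 kexp -scalerAr mulr1.
  by rewrite zk -scalerAl mul1r scalerA -exprS.
set N := n.+1; set D := i (d z) ^+ N.
have D0 : D <> 0 by move/domain_exp/dz.
have dN m : (k ^+ m *: i (d z) *+ m.+1) ^+ N = (k ^+ (m * N) *+ m.+1 ^ N) *: D.
  by rewrite exprMn_n exprZn -exprM scalerMnl.
have [y2 y2E dy2] := dexp 1%N; have [y3 y3E dy3] := dexp 2%N.
have iy2 : y2 = (z * z)%nu by apply: (@i_inj _ K); rewrite cliM y2E expr2.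
have iy3 : y3 = (z * y2)%nu by apply: (@i_inj _ K); rewrite cliM y3E y2E exprS.
have DD : D * D = (k ^+ (1 * N) *+ 2 ^ N) *: D by rewrite -dN -dy2 iy2 idXn.
have DDD : D * (D * D) = (k ^+ (2 * N) *+ 3 ^ N) *: D.
  by rewrite -dN -dy3 iy3 idXn -/D iy2 idXn.
have kN : (k ^+ (1 * N) *+ 2 ^ N) ^+ 2 = k ^+ (2 * N) *+ 3 ^ N.
  have /eqP := DDD; rewrite DD -scalerAr DD scalerA -subr_eq0 -scalerBl scaler_eq0.
  by rewrite (introF eqP D0) orbF subr_eq0 -expr2 => /eqP.
have M0 : (4 ^ N - 3 ^ N)%:R = 0 :> F.
  have lt34 : (3 ^ N <= 4 ^ N)%N by rewrite leq_exp2r.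
  apply/eqP; rewrite natrB // subr_eq0; apply/eqP.
  apply: (mulfI (expf_neq0 (2 * N) k0)); rewrite !mulr_natr -kN.
  by rewrite exprMn_n -exprM mul1n mulnC -expnM mulnC expnM.
have lt34 : (3 ^ N < 4 ^ N)%N by rewrite ltn_exp2r.
have [y yE dy] := dexp (4 ^ N - 3 ^ N).-1.
apply: (domain_constant (c := y)) => [y0|].
  by apply: z0; apply: (@domain_exp _ (4 ^ N - 3 ^ N).-1.+1); rewrite -yE y0 i0.
apply: (@cli_inj _ K); rewrite dy prednK ?subn_gt0 //.
by rewrite scalerMnl -mulr_natl M0 mul0r scale0r.
Qed.

End Domain.

(** * Rings with a finite corner *)

Section FiniteCorner.
Variables (R : nuRingType) (primeR : prime_nuring R) (K : mquotient R).
Local Notation F := (clF K).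
Local Notation Q := (clQ K).
Local Notation i := (@cli R K).
Implicit Types (x y z r s u v c w : R) (p q t : Q) (W : seq Q).

(** A multiplication operator with values in [R] composed with multiplication by
    [p] still has values in [R] on a nonzero ideal, uniformly in the operator. *)
Lemma poly_in_mop w p : poly_in (i w) p ->
  large (fun u => forall E, exists v, mop E (i u) * p = i v).
Proof.
have TL : large (fun _ : R => True) by have [a a0 _] := cl_dom (1 : Q); exists a.
elim=> [|k q _ IH].
  by apply: large_imp TL => u _ E; exists 0; rewrite mulr0 i0.
apply: large_imp (largeI primeR IH (cl_dom (k%:A : Q))) => u [h [v kv]] E.
have [v1 v1E] := h [seq (e.1, (e.2 * w)%nu) | e <- E].
exists (\sum_(e <- E) (e.1 * v * e.2)%nu + v1).
rewrite mulrDr mulrA -mop_mulr v1E cliD i_sum; congr (_ + _).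
rewrite -scalar_comm -scalerAl mul1r -mopZ /mop; apply: eq_bigr => e _.
by rewrite !cliM -kv -scalerAl mul1r.
Qed.

Lemma poly_in_span w p x : poly_in (i w) p -> exists l : seq R, spn (map i l) (i x * p).
Proof.
move=> pw; elim: pw x => [|k q _ IH] x; first by exists [::]; rewrite /= mulr0.
have [l xl] := IH (x * w)%nu; exists (x :: l), k.
by rewrite mulrDr -scalar_comm -scalerAl mul1r addrAC subrr add0r mulrA -cliM.
Qed.

Variables (d : R -> R) (der_d : derivation d) (n : nat).
Hypothesis dXn : forall x y, (d (x * y) ^+ n.+1 = d x ^+ n.+1 * d y ^+ n.+1)%nu.

(** On a finite-dimensional [R] there is a multiplication operator [E] whose values are
    scalar multiples of a single nonzero [w] in [R]. Being algebraic, [w] is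
    inverted by a polynomial [p] in [w]; so the values of [E] multiplied by [p] are
    scalars, and by [poly_in_mop] some of these are nonzero elements of [R]. *)
Lemma finite_domain_der0 W : (exists x, x <> 0) ->
  (forall x y, (x * y)%nu = 0 -> x = 0 \/ y = 0) ->
  (forall x, spn W (i x)) -> forall x, d x = 0.
Proof.
move=> [x0 x00] domain RW.
have cancel := @domain_cancel R K domain.
have inv (w : R) : w <> 0 -> exists2 p, poly_in (i w) p & i w * p = 1.
  move=> w0; have [|m [p [_ pw h]]] := @pows_finite R K (i w) 1 W.
    move=> [//|j] _; rewrite mulr1; suff [y ->] : exists y, i w ^+ j.+1 = i y by [].
    elim: j => [|j [y yE]]; first by exists w; rewrite expr1.
    by exists (w * y)%nu; rewrite exprS yE cliM.
  exists p => //; apply/esym/eqP; rewrite -subr_eq0; apply/eqP.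
  have {h} : i w ^+ m * (1 - i w * p) = 0.
    by rewrite mulrBr h mulr1 exprSr mulrA subrr.
  elim: m => [|m IH]; first by rewrite expr0 mul1r.
  by rewrite exprS -mulrA => /(cancel _ _ w0).
have [[|v1 rest] [fvs vsR Rvs]] := free_extract (S := fun q => exists x, q = i x)
  (fun q '(ex_intro x e) => eq_ind_r (fun q => spn W q) (RW x) e).
  by case: x00; apply: (@cli_inj _ K); apply: (Rvs (i x0)); exists x0.
have [nv1 _] := fvs; rewrite cats0 in nv1.
have [E Ev1 Erest] := mop_separate primeR nv1.
have [r1 r1E] : exists r, v1 = i r by apply: vsR; rewrite inE eqxx.
have [w wE] : exists w, mop E v1 = i w.
  exists (\sum_(e <- E) (e.1 * r1 * e.2)%nu).
  by rewrite i_sum r1E; apply: eq_bigr => e _; rewrite !cliM.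
have w0 : w <> 0 by move=> w0; apply: Ev1; rewrite wE w0 i0.
have Ex x : exists k : F, mop E (i x) = k *: i w.
  have [k h] : spn (v1 :: rest) (i x) by apply: Rvs; exists x.
  exists k; apply/eqP; rewrite -wE -mopZ -subr_eq0 -mopB; apply/eqP.
  exact: mop_spn Erest h.
have [p pw wp] := inv w w0.
have [a a0 aE] := poly_in_mop pw.
have [[r [s nz]]|h] := pselect (exists r s, mop E (i (r * a * s)%nu) <> 0).
  have [v vE] := aE r s E; have [k kE] := Ex (r * a * s)%nu.
  apply: (domain_central (K := K) der_d dXn domain (z := v) (k := k)) => [|].
    move=> v0; apply: nz; rewrite -[LHS]mulr1 -wp -(poly_in_comm pw) mulrA vE v0 i0.
    exact: mul0r.
  by rewrite -vE kE -scalerAl wp.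
have {}h r s : mop E (i (r * a * s)%nu) = 0.
  by apply: contrapT => nz; apply: h; exists r, s.
case: Ev1; rewrite r1E.
(* otherwise [E] vanishes on [R a R], whose span contains [R] as [a] is invertible *)
have aa0 : (a * a)%nu <> 0 by move=> aa; case: (domain _ _ aa).
have [q qaa aq] := inv _ aa0; have [l lq] := poly_in_span a qaa.
have -> : i r1 = i r1 * i a * (i a * q) by rewrite -mulrA [i a * _]mulrA -cliM aq mulr1.
have := spn_mul (i r1 * i a) 1 lq; rewrite mulr1.
apply: mop_spn => _ /mapP[_ /mapP[s _ ->] ->].
by rewrite mulr1 -!cliM.
Qed.

(** If [d] is nonzero, a nonzero idempotent with left denominators has to be [1], so
    [c] has a right inverse whenever the corner [c R c] is finite-dimensional. For
    [t * u * c] in place of [c] this shows that [s * t = 0] implies [s = 0]; so [R]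
    is a domain, [c] is invertible, and [R] is as finite-dimensional as [c R c]. *)
Lemma finite_corner_der0 : finite_corner K -> forall x, d x = 0.
Proof.
move=> [a [b [W [a0 b0 abW]]]]; apply: contrapT => dn0.
have idem1 (e : Q) : e * e = e -> ldom e -> e <> 0 -> e = 1.
  move=> ee le e0; apply: contrapT => e1; apply: dn0 => x.
  exact: (nontrivial_idempotent primeR der_d dXn ee le e0 e1 x).
have [r c0] := prime_sep primeR b0 a0; set c := (b * r * a)%nu in c0.
have cW x : spn [seq (i b * i r) * q * (i r * i a) | q <- W] (i c * i x * i c).
  apply: spn_cong (spn_mul (i b * i r) (i r * i a) (abW x)).
  by rewrite /c !cliM !mulrA.
have right_inv (t : R) W' : t <> 0 -> (forall x, spn W' (i t * i x * i t)) ->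
    exists p, i t * p = 1.
  move=> t0 /(corner_idempotent primeR t0)[e [p [ee le e0 ep]]].
  by exists p; rewrite -ep; apply: idem1.
have domain (s t : R) : (s * t)%nu = 0 -> s = 0 \/ t = 0.
  move=> st; have [->|t0] := pselect (t = 0); [by right|left].
  have [u tc0] := prime_sep primeR t0 c0; set W' := [seq _ | q <- W] in cW.
  have [|p pE] := right_inv (t * u * c)%nu [seq (i t * i u) * q * 1 | q <- W'] tc0.
    move=> x; have := spn_mul (i t * i u) 1 (cW (x * t * u)%nu).
    by apply: spn_cong; rewrite !cliM; ncring.
  apply: (@cli_inj _ K); rewrite -[LHS]mulr1 -pE !cliM !mulrA -cliM st i0.
  by rewrite !mul0r.
have [p pE] := right_inv c _ c0 cW.
have pE' : p * i c = 1.
  apply/eqP; rewrite -subr_eq0; apply/eqP; apply: (domain_cancel domain c0).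
  by rewrite mulrBr mulrA pE mul1r mulr1 subrr.
move: cW; set W1 := [seq _ | q <- W] => cW.
apply/dn0/(finite_domain_der0 (W := [seq p * q * p | q <- W1])) => // [|x].
  by exists c.
apply: spn_cong (spn_mul p p (cW x)).
by rewrite !mulrA pE' mul1r -mulrA pE mulr1.
Qed.

End FiniteCorner.

(** * The theorem *)

Local Open Scope nuring_scope.

Theorem theorem1p1 (R : nuRingType) (d : R -> R) (n : nat)
    (primeR : prime_nuring R) (der_d : derivation d) (n_gt0 : (1 <= n)%N)
    (dXn : forall x y : R, d (x * y) ^+ n = d x ^+ n * d y ^+ n) :
  (forall x : R, d x = 0%R) \/ (forall x y : R, x * y = y * x).
Proof.
left; case: n n_gt0 dXn => // n _ dXn.
have [nzR|zR] := pselect (exists a : R, a <> 0%R); last first.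
  by move=> x; apply: contrapT => dx; apply: zR; exists (d x).
have [K] := mquotient_exists primeR nzR.
have [fc|nfc] := pselect (finite_corner K).
  exact: (finite_corner_der0 primeR der_d dXn fc).
exact: (no_corner_der0 primeR der_d nfc dXn).
Qed.
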